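(* There exist absolute constants $c>0$ and $C>0$ such that the following holds. Let $A,B\subset\mathbb{R}$ be finite sets with more than one element, let $M\geq 1$, and suppose $|AA|\le M|A|$ and $|A|\le|B|^2$. Then $$\mathsf{E}^+(A,B)\le C M^{C}\,|B|^{5/3}|A|^{5/6-c}.$$
   Context: $AA=\{aa':a,a'\in A\}$. $\mathsf{E}^+(A,B)=|\{(a,a',b,b')\in A\times A\times B\times B: a-b=a'-b'\}|$. *)

(* Defs.v *)
From mathcomp Require Import all_boot all_order all_algebra.
From mathcomp Require Import finmap.
From mathcomp Require Import reals exp.

Set Implicit Arguments.
Unset Strict Implicit.
Unset Printing Implicit Defensive.

Import Order.TTheory GRing.Theory Num.Theory.
Local Open Scope ring_scope.
Local Open Scope fset_scope.

Definition productset (R : realType) (A : {fset R}) : {fset R} :=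
  [fset a * a' | a in A, a' in A].

(* A quadruple (a, a', b, b') is encoded as ((a, a'), (b, b')). *)
Definition additive_energy (R : realType) (A B : {fset R}) : nat :=
  #|` [fset q in (A `*` A) `*` (B `*` B) | q.1.1 - q.2.1 == q.1.2 - q.2.2] |.

(* Main.v *)
Require Import Defs.
From mathcomp Require Import all_boot all_order all_algebra.
From mathcomp Require Import finmap.
From mathcomp Require Import reals exp.
From mathcomp Require Import zify ring lra.

(** Write N = |A|, n = |B| and suppose first that 0 is not in A.  For s >= 1
    let D(s) be the set of x <> 0 with at least s representations as a
    difference of two elements of A (or of a small power of A).  Since A has
    few products, D(s) is nearly invariant under multiplication by A, so an
    additive relation among elements of D(s) becomes |A| incidences between
    lines and points of a Cartesian product with one factor 1/A.  For Cartesian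
    products the Szemeredi-Trotter bound only needs a grid of equal blocks, and
    it yields, up to powers of M,
      |D(s)| << N^3 / s^3,   #{b - b' in D(s)} << N^(5/3) n^(4/3) / s^2,
      #{d1 + d2 = d3, di in D(si)} << N^(17/3) / (s1 s2 s3)^2.
    The triangles (b1, b2, b3) of B with bi - bj in the sets D(s) are counted
    through their images under scaling by A: two triangles with a common
    scaled image are similar, and pairs of similar triangles are collinear
    triples of B x B, of which there are << n^4 log n.  Cauchy-Schwarz gives
      #triangles << N^(7/3) n^2 / (s1 s2 s3).
    On the other hand the energy is the sum of the entries of the positive
    semidefinite matrix r(b - b'), r the representation function of A - A, so
    its cube is at most about n^3 times the trace of the third power, which is
    a sum over such triangles.  Hence E << n^(5/3) N^(7/9) up to logarithms,
    and 7/9 < 5/6. *)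

Set Implicit Arguments.
Unset Strict Implicit.
Unset Printing Implicit Defensive.

Import Order.TTheory GRing.Theory Num.Theory.
Local Open Scope fset_scope.
Local Open Scope nat_scope.

(** * Counting in finite sets *)

Lemma leq_card_fset (T U : choiceType) (f : T -> U) (P : {fset T}) (Q : {fset U}) :
  {in P &, injective f} -> (forall x, x \in P -> f x \in Q) -> #|` P| <= #|` Q|.
Proof.
move=> injf fPQ; rewrite -(card_in_imfset imfset_key injf).
by apply/fsubset_leq_card/fsubsetP=> _ /imfsetP[x /= xP ->]; exact: fPQ.
Qed.

Lemma card_fset_sum (T : choiceType) (A : {fset T}) (P : pred T) :
  #|` [fset x in A | P x]| = \sum_(x <- A) P x.
Proof.
rewrite cardfE -sum1_card -(big_seq_fsetE _ _ predT (fun=> 1)) /= big_fset /= big_mkcond /=.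
by apply: eq_bigr => x _; case: (P x).
Qed.

Lemma big_fsetM (R : Type) (idx : R) (op : Monoid.com_law idx) (T U : choiceType)
    (A : {fset T}) (B : {fset U}) (F : T * U -> R) :
  \big[op/idx]_(p <- A `*` B) F p = \big[op/idx]_(a <- A) \big[op/idx]_(b <- B) F (a, b).
Proof.
rewrite -big_allpairs; apply: perm_big; apply: uniq_perm.
- exact: fset_uniq.
- by rewrite allpairs_uniq ?fset_uniq // => -[x y] [z t].
move=> [a b]; rewrite in_fsetM /=; apply/andP/allpairsP => [[aA bB]|[[x y] /= [xA yB [-> ->]]]] //.
by exists (a, b).
Qed.

(** * Incidences with Cartesian products *)

(** A fibre of k elements exceeds its single image by k - 1, which is at most its k (k - 1) ordered
    pairs of distinct elements. *)
Lemma size_le_image_pairs (T : eqType) (f : T -> nat) (s : seq T) :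
  uniq s ->
  size s <= size (undup [seq f x | x <- s])
            + \sum_(x <- s) \sum_(y <- s) ((x != y) && (f x == f y)).
Proof.
elim: s => //= x s IHs /andP[xNs /IHs{IHs}].
rewrite big_cons big_cons eqxx add0n => IHs.
have le1 : \sum_(x0 <- s) \sum_(y <- s) ((x0 != y) && (f x0 == f y)) <=
  \sum_(j <- s) \sum_(j0 <- x :: s) ((j != j0) && (f j == f j0)).
  by apply: leq_sum => z _; rewrite big_cons leq_addl.
case: ifP => [/mapP[y ys fxy]|_]; last by rewrite /=; lia.
have : 0 < \sum_(j <- s) ((x != j) && (f x == f j)).
  rewrite (big_rem y) //= fxy eqxx andbT.
  by case: eqP xNs => [->|]; rewrite ?ys.
lia.
Qed.

Section Blocks.
Context {R : realDomainType}.
Implicit Types (X Y : {fset R}) (x y : R) (w : nat).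

(** The sorted set is cut into runs of w consecutive elements. The rank gives every x a number, in
    [X] or not, so the map is monotone on the whole ring. *)
Definition block X w x := #|` [fset y in X | (y < x)%O]| %/ w.

Lemma block_le X w x y : (x <= y)%O -> block X w x <= block X w y.
Proof.
move=> xy; apply/leq_div2r/fsubset_leq_card/fsubsetP => z.
by rewrite !inE /= => /andP[-> /lt_le_trans]; apply.
Qed.

Lemma block_lt X w x : block X w x <= #|` X| %/ w.
Proof.
apply/leq_div2r/fsubset_leq_card/fsubsetP => z.
by rewrite !inE /= => /andP[->].
Qed.

Lemma rank_inj X : {in X &, injective (fun x => #|` [fset y in X | (y < x)%O]|)}.
Proof.
have H x y : x \in X -> (x < y)%O ->
    #|` [fset z in X | (z < x)%O]| < #|` [fset z in X | (z < y)%O]|.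
  move=> xX xy; apply: fproper_ltn_card; rewrite fproperE; apply/andP; split.
    by apply/fsubsetP => z; rewrite !inE /= => /andP[-> /lt_trans]; apply.
  by apply/negP => /fsubsetP/(_ x); rewrite !inE /= xX xy ltxx => /(_ isT).
move=> x y xX yX /= e; case: (ltgtP x y) => // xy.
- by have := H _ _ xX xy; rewrite e ltnn.
- by have := H _ _ yX xy; rewrite e ltnn.
Qed.

Lemma card_block X w k : 0 < w -> #|` [fset x in X | block X w x == k]| <= w.
Proof.
move=> w0; rewrite -[leqRHS](size_iota 0) -(undup_id (iota_uniq 0 w)) -card_fseq.
apply: (@leq_card_fset _ _ (fun x => #|` [fset y in X | (y < x)%O]| %% w)).
  move=> x y; rewrite !inE /= => /andP[xX /eqP bx] /andP[yX /eqP by_] e.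
  apply: (rank_inj xX yX) => /=.
  rewrite (divn_eq #|` [fset _ in X | (_ < x)%O]| w).
  by rewrite [RHS](divn_eq _ w) e -/(block X w x) bx -by_.
by move=> x _; rewrite !inE mem_iota /= add0n ltn_pmod.
Qed.

(* A line is a monotone graph, so the cells that it meets form a chain in the
   product order on pairs of block numbers. *)
Lemma line_cells X Y w w' (l : R * R) : 0 < w -> 0 < w' ->
  \sum_(x <- X) ((l.1 * x + l.2)%R \in Y : nat) <=
  (#|` X| %/ w + #|` Y| %/ w' + 1) +
  \sum_(x <- X) \sum_(x' <- X)
    [&& (l.1 * x + l.2)%R \in Y, (l.1 * x' + l.2)%R \in Y, x != x',
        block X w x == block X w x' &
        block Y w' (l.1 * x + l.2)%R == block Y w' (l.1 * x' + l.2)%R].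
Proof.
move=> w0 w'0; case: l => p q /=.
set V := [fset x in X | (p * x + q)%R \in Y].
pose c2 x := block Y w' (p * x + q)%R.
(* Along a line both block numbers move in one direction; for negative slope the row number is
   reversed. Hence [g] is nondecreasing in x, and two points share a value only inside one cell. *)
pose g x := if (0 <= p)%R then block X w x + c2 x
            else block X w x + (#|` Y| %/ w' - c2 x).
have gc x x' : (x < x')%O -> g x = g x' ->
    block X w x = block X w x' /\ c2 x = c2 x'.
  move=> xx'; have := block_le X w (ltW xx').
  have := block_lt Y w' (p * x + q)%R; have := block_lt Y w' (p * x' + q)%R.
  rewrite /g -!/(c2 _); case: (lerP 0 p) => p0.
    suff : c2 x <= c2 x' by lia.
    by apply: block_le; rewrite lerD2r ler_wpM2l // ltW.
  suff : c2 x' <= c2 x by lia.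
  by apply: block_le; rewrite lerD2r ler_wnM2l // ltW.
have gE x x' : x != x' -> g x = g x' ->
    block X w x = block X w x' /\ c2 x = c2 x'.
  case: (ltgtP x x') => // xx' _ e; first exact: gc.
  by have [-> ->] := gc _ _ xx' (esym e).
rewrite -card_fset_sum -/V.
apply: (leq_trans (size_le_image_pairs g (fset_uniq V))); apply: leq_add.
  rewrite -[leqRHS](size_iota 0); apply: uniq_leq_size; first exact: undup_uniq.
  move=> k; rewrite mem_undup => /mapP[x _ ->]; rewrite mem_iota add0n /g.
  have := block_lt X w x; have := block_lt Y w' (p * x + q)%R.
  by rewrite -!/(c2 _); case: ifP => _; lia.
rewrite big_fset /= big_mkcond; apply: leq_sum => x _.
case: ifP => xV //; rewrite big_fset /= big_mkcond; apply: leq_sum => x' _.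
case: ifP => x'V //; rewrite /=; case: (eqVneq x x') => //= xx'.
by case: (g x =P g x') => //= /(gE _ _ xx')[-> e]; rewrite -!/(c2 _) e !eqxx.
Qed.

End Blocks.

Section Incidences.
Context {R : realDomainType}.
Implicit Types (X Y : {fset R}) (S : {fset R * R}).

Definition incidences X Y S :=
  \sum_(l <- S) \sum_(x <- X) ((l.1 * x + l.2)%R \in Y : nat).

(* Two distinct points determine the line, so the pairs counted by line_cells
   are, over all lines, at most the pairs of points in a common cell. *)
Lemma incidences_blocks X Y S w w' : 0 < w -> 0 < w' ->
  incidences X Y S <=
  (#|` X| %/ w + #|` Y| %/ w' + 1) * #|` S| + #|` X| * #|` Y| * (w * w').
Proof.
move=> w0 w'0.
pose F (l : R * R) x x' := [&& (l.1 * x + l.2)%R \in Y, (l.1 * x' + l.2)%R \in Y,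
   x != x', block X w x == block X w x' &
   block Y w' (l.1 * x + l.2)%R == block Y w' (l.1 * x' + l.2)%R].
apply: (@leq_trans (\sum_(l <- S) ((#|` X| %/ w + #|` Y| %/ w' + 1) +
    \sum_(x <- X) \sum_(x' <- X) (F l x x' : nat)))).
  by apply: leq_sum => l _; exact: line_cells.
rewrite big_split /= leq_add //.
  by rewrite big_const_seq iter_addn_0 count_predT.
pose U := [fset t in S `*` (X `*` X) | F t.1 t.2.1 t.2.2].
have -> : \sum_(l <- S) \sum_(x <- X) \sum_(x' <- X) (F l x x' : nat) = #|` U|.
  rewrite card_fset_sum big_fsetM; apply: eq_bigr => l _.
  by rewrite big_fsetM.
pose W := [fset t in (X `*` Y) `*` (X `*` Y) |
  (block X w t.1.1 == block X w t.2.1) && (block Y w' t.1.2 == block Y w' t.2.2)].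
apply: (@leq_trans #|` W|).
  apply: (@leq_card_fset _ _ (fun t : (R * R) * (R * R) =>
     ((t.2.1, t.1.1 * t.2.1 + t.1.2), (t.2.2, t.1.1 * t.2.2 + t.1.2))%R)).
    move=> [[p q] [x x']] [[p' q'] [z z']]; rewrite !inE /= /F /=.
    move=> /andP[_ /and5P[_ _ xx' _ _]] _ [xz e x'z' e']; subst z z'.
    have pp : p = p'.
      have : (p * (x - x') = p' * (x - x'))%R by lra.
      by apply: mulIf; rewrite subr_eq0.
    by subst p'; move: e => /addrI ->.
  move=> [[p q] [x x']]; rewrite !inE /= /F /=.
  by move=> /andP[/andP[_ /andP[-> ->]] /and5P[-> -> _ -> ->]].
rewrite card_fset_sum big_fsetM big_fsetM.
(* Each of the |X| |Y| points shares its cell with at most w w' points. *)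
rewrite [leqRHS](_ : _ = \sum_(x <- X) \sum_(y <- Y) w * w'); last first.
  by rewrite !big_const_seq !iter_addn_0 !count_predT; ring.
apply: leq_sum => x _; apply: leq_sum => y _; rewrite big_fsetM /=.
rewrite (eq_bigr (fun x' => (block X w x == block X w x') *
    (\sum_(y' <- Y) (block Y w' y == block Y w' y')))); last first.
  by move=> x' _; rewrite big_distrr /=; apply: eq_bigr => y' _; rewrite mulnb.
rewrite -big_distrl /= leq_mul //.
  rewrite -(card_fset_sum X (fun x' => block X w x == block X w x')).
  rewrite (_ : [fset _ in X | _] = [fset x' in X | block X w x' == block X w x]) ?card_block //.
  by apply/fsetP => z; rewrite !inE eq_sym.
rewrite -(card_fset_sum Y (fun x' => block Y w' y == block Y w' x')).
rewrite (_ : [fset _ in Y | _] = [fset x' in Y | block Y w' x' == block Y w' y]) ?card_block //.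
by apply/fsetP => z; rewrite !inE eq_sym.
Qed.

End Incidences.

(* Locked, so that conversion never evaluates its powers in unary. *)
Definition incidence_const : nat := locked (28 ^ 3).

Lemma incidence_const_gt0 : 0 < incidence_const.
Proof. by rewrite /incidence_const -lock. Qed.

(** Szemeredi-Trotter in cubed form. Balancing the two terms of [incidences_blocks] asks for about r
    blocks per side, with r^3 = (|X| |Y|)^2 / |S|. Up to the loss [lam], the hypotheses say in turn
    that r <= |X|, r <= |Y| and 1 <= r. *)
Lemma incidences_cube (R : realDomainType) (X Y : {fset R}) (S : {fset R * R}) lam :
  (#|` X| * #|` Y|) ^ 2 <= lam * #|` S| * #|` X| ^ 3 ->
  (#|` X| * #|` Y|) ^ 2 <= lam * #|` S| * #|` Y| ^ 3 ->
  #|` S| <= lam * (#|` X| * #|` Y|) ^ 2 ->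
  incidences X Y S ^ 3 <= incidence_const * lam ^ 4 * (#|` X| * #|` Y|) ^ 2 * #|` S| ^ 2.
Proof.
rewrite /incidence_const -lock; have := @incidences_blocks R X Y S.
set I := incidences X Y S; set n := #|` X|; set n' := #|` Y|; set L := #|` S|.
set P := n * n' => Iw PX PY LP.
(* With widths [(n %/ r).+1] and [(n' %/ r).+1] a line meets at most r + r + 1 <= 3 r cells, and a
   cell holds at most 4 P / r^2 points. *)
have Ir r : 0 < r -> r <= n -> r <= n' -> r ^ 2 * I <= 3 * r ^ 3 * L + 4 * P ^ 2.
  move=> r0 rn rn'.
  have Hw m : r <= m -> m %/ (m %/ r).+1 <= r /\ r * (m %/ r).+1 <= 2 * m.
    move=> rm; split; first by rewrite -ltnS ltn_divLR // (leq_trans (ltn_ceil m r0)) // mulnC leq_mul.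
    by rewrite mulnS mulnC mul2n -addnn leq_add // leq_divM.
  have [h1 h2] := Hw _ rn; have [h3 h4] := Hw _ rn'.
  have {Hw} := Iw (n %/ r).+1 (n' %/ r).+1 isT isT => {Iw} IH.
  apply: (@leq_trans (r ^ 2 * ((r + r + r) * L + P * ((n %/ r).+1 * (n' %/ r).+1)))).
    rewrite leq_mul2l (leq_trans IH) ?orbT // leq_add2r leq_mul2r.
    by rewrite !leq_add ?orbT.
  rewrite mulnDr leq_add //.
    by rewrite (_ : r ^ 2 * _ = 3 * r ^ 3 * L) //; ring.
  rewrite (_ : r ^ 2 * _ = P * ((r * (n %/ r).+1) * (r * (n' %/ r).+1))); last by ring.
  rewrite (_ : 4 * P ^ 2 = P * ((2 * n) * (2 * n'))); last by rewrite /P; ring.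
  by rewrite leq_mul2l leq_mul ?orbT.
have [P0|P0] := posnP P.
  have L0 : L = 0 by apply/eqP; move: LP; rewrite P0 exp0n // muln0 leqn0.
  by have := Iw 1 1 isT isT; rewrite -/P P0 L0 muln0 mul0n leqn0 => /eqP ->; rewrite exp0n.
have L0 : 0 < L.
  move: PX; rewrite lt0n; apply: contraTN => /eqP ->.
  by rewrite muln0 mul0n -ltnNge expn_gt0 P0.
have /andP[n0 n'0] : (0 < n) && (0 < n') by rewrite -muln_gt0.
have lam0 : 0 < lam by move: LP; rewrite !lt0n; apply: contraTN => /eqP->; rewrite -ltnNge.
(* If P^2 < lam L, the choice r = 1 gives I <= 7 lam L, and L <= lam P^2 trades away one factor
   L. *)
case: (ltnP (P ^ 2) (lam * L)) => small.
  have IL : I <= 7 * (lam * L) by have := Ir 1 isT n0 n'0; nia.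
  apply: (@leq_trans ((7 * (lam * L)) ^ 3)); first by rewrite leq_exp2r.
  rewrite (_ : _ ^ 3 = 343 * lam ^ 3 * L ^ 2 * L); last by ring.
  rewrite (_ : 28 ^ 3 * _ * _ * _ = 28 ^ 3 * lam ^ 3 * L ^ 2 * (lam * P ^ 2)); last by ring.
  by rewrite leq_mul // leq_mul // leq_mul.
(* Otherwise r is the largest number with r^3 lam L <= P^2. Then r^2 I <= 7 P^2, and maximality
   gives P^2 <= (2 r)^3 lam L, which eliminates r. *)
have exr : exists r, (0 < r) && (r ^ 3 * (lam * L) <= P ^ 2).
  by exists 1; rewrite /= exp1n mul1n.
have ubr r : (0 < r) && (r ^ 3 * (lam * L) <= P ^ 2) -> r <= n.
  case/andP=> _ /leq_trans/(_ PX); rewrite mulnC leq_pmul2l ?muln_gt0 ?lam0 //.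
  by rewrite leq_exp2r.
case: (ex_maxnP exr ubr) => r /andP[r0 rP] rmax.
have rn : r <= n by apply: ubr; rewrite r0.
have rn' : r <= n'.
  move: (leq_trans rP PY); rewrite mulnC leq_pmul2l ?muln_gt0 ?lam0 //.
  by rewrite leq_exp2r.
have rL : r ^ 3 * L <= P ^ 2.
  by apply: leq_trans rP; rewrite leq_mul2l leq_pmull ?orbT.
have r7 : r ^ 2 * I <= 7 * P ^ 2 by have := Ir r r0 rn rn'; lia.
have P8 : P ^ 2 <= (2 * r) ^ 3 * (lam * L).
  rewrite leqNgt; apply/negP => H.
  have /rmax : (0 < r.+1) && (r.+1 ^ 3 * (lam * L) <= P ^ 2).
    apply: leq_trans (ltnW H); rewrite leq_mul2r leq_exp2r //; apply/orP; right; lia.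
  by rewrite ltnn.
have r6 : 0 < r ^ 6 * P ^ 4 by rewrite muln_gt0 !expn_gt0 r0 P0.
rewrite -(leq_pmul2l r6).
rewrite (_ : r ^ 6 * P ^ 4 * I ^ 3 = (r ^ 2 * I) ^ 3 * (P ^ 2) ^ 2); last by ring.
apply: (@leq_trans ((7 * P ^ 2) ^ 3 * ((2 * r) ^ 3 * (lam * L)) ^ 2)).
  by rewrite leq_mul // leq_exp2r.
rewrite (_ : _ * _ = r ^ 6 * P ^ 4 * (28 ^ 3 * lam ^ 2 * P ^ 2 * L ^ 2)); last by ring.
rewrite leq_mul2l; apply/orP; right.
by rewrite leq_mul2r leq_mul2r leq_mul2l leq_pexp2l // !orbT.
Qed.

(** * Pluennecke's inequality *)

Lemma exists_min_seq d (K : orderType d) (T : eqType) (f : T -> K) (s : seq T) : s != [::] ->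
  exists2 x, x \in s & forall y, y \in s -> (f x <= f y)%O.
Proof.
elim: s => // x [|y s] IHs _.
  by exists x; rewrite ?inE // => z; rewrite inE => /eqP ->.
have [z zs zmin] := IHs isT; case: (leP (f x) (f z)) => xz.
  exists x; rewrite ?inE ?eqxx // => t; rewrite inE => /predU1P[->//|/zmin].
  exact: le_trans.
exists z; first by rewrite inE zs orbT.
by move=> t; rewrite inE => /predU1P[->|/zmin//]; apply: ltW.
Qed.

Section ProductSets.
Context {F : fieldType}.
Implicit Types (A B C X Z : {fset F}) (x y : F) (m k : nat).

Definition mulfset A B : {fset F} := [fset (a * b)%R | a in A, b in B].

Lemma mulfsetP A B y :
  reflect (exists a b, [/\ a \in A, b \in B & y = (a * b)%R]) (y \in mulfset A B).
Proof.
apply: (iffP (imfset2P _ _ _ _ _)) => [[a /= aA [b /= bB ->]]|[a [b [aA bB ->]]]].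
  by exists a, b.
by exists a => //; exists b.
Qed.

Lemma mem_mulfset A B a b : a \in A -> b \in B -> (a * b)%R \in mulfset A B.
Proof. by move=> aA bB; apply/mulfsetP; exists a, b. Qed.

Lemma mulfsetA A B C : mulfset A (mulfset B C) = mulfset (mulfset A B) C.
Proof.
apply/fsetP => y; apply/mulfsetP/mulfsetP => [[a [_ [aA /mulfsetP[b [c [bB cC ->]]] ->]]]|].
  by exists (a * b)%R, c; rewrite mulrA mem_mulfset.
move=> [_ [c [/mulfsetP[a [b [aA bB ->]]] cC ->]]].
by exists a, (b * c)%R; rewrite mulrA mem_mulfset.
Qed.

Lemma mulfsetC A B : mulfset A B = mulfset B A.
Proof.
apply/fsetP => y; apply/mulfsetP/mulfsetP => [] [a [b [aA bB ->]]];
  by exists b, a; rewrite mulrC.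
Qed.

Lemma card_mulfset1 A y : y != 0%R -> #|` mulfset A [fset y]| = #|` A|.
Proof.
move=> y0; have -> : mulfset A [fset y] = [fset (a * y)%R | a in A].
  apply/fsetP => z; apply/mulfsetP/imfsetP => [[a [b [aA]]]|[a /= aA ->]].
    by rewrite inE => /eqP -> ->; exists a.
  by exists a, y; rewrite !inE.
by rewrite card_in_imfset // => a b _ _; apply: mulIf.
Qed.

Lemma mulfset_neq0 A B : 0%R \notin A -> 0%R \notin B -> 0%R \notin mulfset A B.
Proof.
move=> A0 B0; apply/mulfsetP => -[a [b [aA bB /esym/eqP]]].
rewrite mulf_eq0 => /orP[]/eqP e; first by rewrite -e aA in A0.
by rewrite -e bB in B0.
Qed.

Lemma leq_card_mulfset A B : (exists2 x, x \in A & x != 0%R) -> #|` B| <= #|` mulfset A B|.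
Proof.
case=> x xA x0; rewrite -(card_mulfset1 B x0).
apply/fsubset_leq_card/fsubsetP => _ /mulfsetP[b [y [bB + ->]]].
by rewrite inE mulrC => /eqP ->; rewrite mem_mulfset.
Qed.

(** The extremal set of Petridis's proof of Pluennecke's inequality; minimality of the ratio |XB| /
    |X| is kept in cross-multiplied form. *)
Lemma exists_min_ratio A B : A != fset0 ->
  exists X, [/\ X `<=` A, X != fset0 &
    forall Z, Z `<=` A -> #|` mulfset X B| * #|` Z| <= #|` mulfset Z B| * #|` X|].
Proof.
move=> A0.
pose f Z := (#|` mulfset Z B|%:R / #|` Z|%:R : rat)%R.
have [|X] := @exists_min_seq _ _ _ f [seq Z <- fpowerset A | Z != fset0].
  apply/eqP => e; have : A \in [seq Z <- fpowerset A | Z != fset0].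
    by rewrite mem_filter A0 fpowersetE fsubset_refl.
  by rewrite e.
rewrite mem_filter fpowersetE => /andP[X0 XA] Xmin; exists X; split=> // Z ZA.
have [->|Z0] := eqVneq Z fset0; first by rewrite cardfs0 muln0.
have : (f X <= f Z)%R by apply: Xmin; rewrite mem_filter Z0 fpowersetE.
have [X1 Z1] : 0 < #|` X| /\ 0 < #|` Z| by rewrite !cardfs_gt0.
rewrite /f ler_pdivrMr ?ltr0n // mulrAC ler_pdivlMr ?ltr0n //.
by rewrite -!natrM ler_nat.
Qed.

(** Induction on C. Let Z be the set of x for which xAy is already covered by XAC. Adding y to C
    creates at most |XA| - |ZA| new elements of XAC and at least |X| - |Z| new elements of XC;
    minimality of X compares the two. *)
Lemma petridis X A C : 0%R \notin C ->
  (forall Z, Z `<=` X -> #|` mulfset X A| * #|` Z| <= #|` mulfset Z A| * #|` X|) ->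
  #|` mulfset (mulfset X A) C| * #|` X| <= #|` mulfset X A| * #|` mulfset X C|.
Proof.
move=> + Xmin; elim/fset1U_rect: C => [_|y C yC IHC].
  rewrite [mulfset _ fset0](_ : _ = fset0) ?cardfs0 //.
  by apply/eqP; rewrite -fsubset0; apply/fsubsetP => z /mulfsetP[a [b [_]]].
rewrite in_fset1U negb_or eq_sym => /andP[y0 /IHC{}IHC].
pose XAC := mulfset (mulfset X A) C.
pose Z := [fset x in X | mulfset (mulfset [fset x] A) [fset y] `<=` XAC].
have ZX : Z `<=` X by apply/fsubsetP => x; rewrite !inE => /andP[].
have ZAX : mulfset Z A `<=` mulfset X A.
  by apply/fsubsetP => _ /mulfsetP[z [a [/(fsubsetP ZX) zX aA ->]]]; rewrite mem_mulfset.
have up : #|` mulfset (mulfset X A) (y |` C)| + #|` mulfset Z A| <=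
    #|` XAC| + #|` mulfset X A|.
  have sub : mulfset (mulfset X A) (y |` C) `<=`
      XAC `|` mulfset (mulfset X A `\` mulfset Z A) [fset y].
    apply/fsubsetP => _ /mulfsetP[t [c [tXA + ->]]]; rewrite in_fset1U in_fsetU.
    case/orP => [/eqP ->|cC]; last by rewrite mem_mulfset.
    have [tZA|tZA] := boolP (t \in mulfset Z A); last first.
      by rewrite (mem_mulfset (B := [fset y])) ?orbT ?inE ?tZA.
    case/mulfsetP: tZA => z [a [zZ aA ->]]; move: zZ; rewrite !inE /=.
    case/andP=> _ /fsubsetP -> //.
    by rewrite (mem_mulfset (B := [fset y])) ?(mem_mulfset (A := [fset z])) ?inE.
  have := leq_trans (fsubset_leq_card sub) (leq_card_fsetU _ _).
  rewrite card_mulfset1 // cardfsDS //.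
  have := fsubset_leq_card ZAX; lia.
have low : #|` mulfset X C| + #|` X| <= #|` mulfset X (y |` C)| + #|` Z|.
  (* If x' y = x c with c in C, then x' A y = x A c is already covered, so x' lies in Z. *)
  have dis : [disjoint mulfset X C & mulfset (X `\` Z) [fset y]]%fset.
    apply/fdisjointP => _ /mulfsetP[x [c [xX cC ->]]].
    apply/negP => /mulfsetP[x' [y' [x'Z yy e]]].
    move: yy e; rewrite inE => /eqP -> e.
    move: x'Z; rewrite !inE => /andP[+ x'X]; rewrite x'X /= => /negP; apply.
    apply/fsubsetP => _ /mulfsetP[t [z [/mulfsetP[u [a [ux aA ->]]] zy ->]]].
    move: ux zy; rewrite !inE => /eqP -> /eqP ->.
    rewrite mulrAC -e mulrAC mem_mulfset //.
    by rewrite mem_mulfset.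
  have sub : mulfset X C `|` mulfset (X `\` Z) [fset y] `<=` mulfset X (y |` C).
    apply/fsubsetP => t; rewrite in_fsetU => /orP[] /mulfsetP[a [b [aX bC ->]]].
      by rewrite mem_mulfset // in_fset1U bC orbT.
    move: aX bC; rewrite !inE => /andP[_ aX] /eqP ->.
    by rewrite mem_mulfset // in_fset1U eqxx.
  have /eqP e : #|` mulfset X C `|` mulfset (X `\` Z) [fset y]| ==
     #|` mulfset X C| + #|` mulfset (X `\` Z) [fset y]|.
    by rewrite (leq_card_fsetU _ _).2.
  have := fsubset_leq_card sub; rewrite e card_mulfset1 // cardfsDS //.
  have := fsubset_leq_card ZX; lia.
have := Xmin _ ZX; rewrite -/XAC in IHC *.
move: IHC up low.
set a := #|` mulfset (mulfset _ _) (_ |` _)|; set b := #|` XAC|.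
set c := #|` mulfset X A|; set d := #|` mulfset X (_ |` _)|; set e := #|` mulfset X C|.
set f := #|` mulfset Z A|; set g := #|` X|; set h := #|` Z|; nia.
Qed.

Definition powfset A k := iter k (mulfset A) [fset 1%R].

Lemma powfsetS A k : powfset A k.+1 = mulfset A (powfset A k).
Proof. by []. Qed.

Lemma powfset_neq0 A k : 0%R \notin A -> 0%R \notin powfset A k.
Proof.
move=> A0; elim: k => [|k IHk]; first by rewrite inE eq_sym oner_eq0.
exact: mulfset_neq0.
Qed.

(** For the minimizing X, [petridis] with C = A^k shows that each further factor A costs one factor
    m. Then A^k embeds into X A^k by scaling with a nonzero element of X, and |X| <= |A|. *)
Lemma card_powfset A m k : 0%R \notin A -> A != fset0 ->
  #|` mulfset A A| <= m * #|` A| -> #|` powfset A k| <= m ^ k * #|` A|.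
Proof.
move=> A0 An AAm; have [X [XA Xn Xmin]] := exists_min_ratio A An.
have XAm : #|` mulfset X A| <= m * #|` X|.
  have := Xmin _ (fsubset_refl A); have : 0 < #|` A| by rewrite cardfs_gt0.
  by move: AAm; set a := #|` A|; set b := #|` mulfset A A|; set c := #|` X|; nia.
have X0 : 0 < #|` X| by rewrite cardfs_gt0.
have XAk : #|` mulfset X (powfset A k)| <= m ^ k * #|` X|.
  elim: k => [|k IHk]; first by rewrite /= card_mulfset1 ?oner_neq0 // mul1n.
  rewrite powfsetS mulfsetA -(leq_pmul2r X0).
  apply: (leq_trans (petridis (powfset_neq0 k A0) _)) => [Z ZX|].
    exact/Xmin/(fsubset_trans ZX).
  by rewrite (leq_trans (leq_mul XAm IHk)) // expnS; lia.
have /fset0Pn[x xX] := Xn.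
have x0 : x != 0%R by apply: contraNneq A0 => <-; exact: (fsubsetP XA).
have /(leq_card_mulfset (powfset A k))/leq_trans-> // : exists2 x, x \in X & x != 0%R.
  by exists x.
by apply: (leq_trans XAk); rewrite leq_mul2l fsubset_leq_card ?orbT.
Qed.

End ProductSets.

#[global] Arguments powfset : simpl never.

(** * Popular differences *)

Lemma in_fset_sep (T : choiceType) (A : {fset T}) (P : pred T) x :
  (x \in [fset y in A | P y]) = (x \in A) && P x.
Proof. by rewrite !inE. Qed.

Section PopularDifferences.
Context {F : fieldType}.
Implicit Types (A P : {fset F}) (x c : F) (s k : nat).

Definition diff_rep P x := \sum_(a <- P) ((a - x)%R \in P : nat).

(** Zero is left out so that scaling an element by distinct c gives distinct elements. *)
Definition popdiff P s : {fset F} :=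
  [fset x in [fset (a - b)%R | a in P, b in P] | (x != 0%R) && (s <= diff_rep P x)].

Lemma mem_popdiff P s x : 0 < s ->
  (x \in popdiff P s) = (x != 0%R) && (s <= diff_rep P x).
Proof.
move=> s0; rewrite !inE /=; apply/andb_idl => /andP[_ sx].
have : diff_rep P x != 0 by rewrite -lt0n (leq_trans s0).
rewrite sum_nat_seq_neq0 => /hasP[a aP]; rewrite /= eqb0 negbK => axP.
by apply/imfset2P; exists a => //; exists (a - x)%R => //; rewrite opprB addrC subrK.
Qed.

Lemma popdiff_neq0 P s x : x \in popdiff P s -> x != 0%R.
Proof. by rewrite !inE => /and3P[]. Qed.

Lemma popdiff_le P s s' : s <= s' -> popdiff P s' `<=` popdiff P s.
Proof.
move=> ss; apply/fsubsetP => x; rewrite !inE /= => /and3P[-> ->].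
exact: leq_trans.
Qed.

Lemma diff_repN P x : diff_rep P (- x)%R = diff_rep P x.
Proof.
rewrite /diff_rep -!card_fset_sum; apply/eqP; rewrite eqn_leq; apply/andP; split.
  apply: (@leq_card_fset _ _ (fun a => a + x)%R) => [a b _ _|a]; first exact: addIr.
  by rewrite !inE /= opprK addrK => /andP[-> ->].
apply: (@leq_card_fset _ _ (fun a => a - x)%R) => [a b _ _|a]; first exact: addIr.
by rewrite !inE /= opprK subrK => /andP[-> ->].
Qed.

Lemma popdiffN P s x : 0 < s -> ((- x)%R \in popdiff P s) = (x \in popdiff P s).
Proof. by move=> s0; rewrite !mem_popdiff // oppr_eq0 diff_repN. Qed.

Definition popdiff_pairs P s :=
  [fset t in P `*` P | (t.1 - t.2)%R \in popdiff P s].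

Lemma card_popdiff_pairs P s : s * #|` popdiff P s| <= #|` popdiff_pairs P s|.
Proof.
pose U := [fset t in popdiff P s `*` P | (t.2 - t.1)%R \in P].
apply: (@leq_trans #|` U|).
  rewrite [leqRHS]card_fset_sum big_fsetM /= mulnC -[#|` _|]sum1_size big_distrl /=.
  rewrite big_seq [leqRHS]big_seq; apply: leq_sum => x.
  by rewrite !inE mul1n => /and3P[].
apply: (@leq_card_fset _ _ (fun t : F * F => (t.2, t.2 - t.1)%R)).
  move=> [x a] [y b] _ _ /= [-> e]; congr (_, _).
  by apply/oppr_inj/(addrI b).
move=> [x a]; rewrite in_fset_sep in_fsetM /= => /andP[/andP[xD aP] axP].
by rewrite in_fset_sep in_fsetM /= aP axP opprB addrC subrK.
Qed.

Lemma card_fsetM (T U : choiceType) (A : {fset T}) (B : {fset U}) :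
  #|` A `*` B| = #|` A| * #|` B|.
Proof.
rewrite card_fset_sum1 big_fsetM -[#|` A|]sum1_size big_distrl /=.
by apply: eq_bigr => a _; rewrite sum1_size mul1n.
Qed.

Lemma card_popdiff_le P s : s * #|` popdiff P s| <= #|` P| ^ 2.
Proof.
apply: (leq_trans (card_popdiff_pairs P s)); rewrite -mulnn -card_fsetM.
by apply/fsubset_leq_card/fsubsetP => t; rewrite !inE => /andP[].
Qed.

(** The near invariance behind the incidence bounds: a representation x = a - b becomes x c = c a -
    c b, at the cost of one more factor A in the base set. *)
Lemma popdiff_mul A P s x c : 0 < s -> 0%R \notin A -> c \in A ->
  x \in popdiff P s -> (x * c)%R \in popdiff (mulfset A P) s.
Proof.
move=> s0 A0 cA; have c0 : c != 0%R by apply: contraNneq A0 => <-.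
rewrite !mem_popdiff // => /andP[x0 /leq_trans sx]; rewrite mulf_neq0 //=.
apply: sx; rewrite /diff_rep -!card_fset_sum.
apply: (@leq_card_fset _ _ (fun a => c * a)%R) => [a b _ _|a]; first exact: mulfI.
rewrite !inE /= => /andP[aP axP]; rewrite mem_mulfset //= [(x * c)%R]mulrC -mulrBr.
by rewrite mem_mulfset.
Qed.

Lemma leq_card_popdiff_mul A P s : 0 < s -> 0%R \notin A -> A != fset0 ->
  #|` popdiff P s| <= #|` popdiff (mulfset A P) s|.
Proof.
move=> s0 A0 /fset0Pn[c cA]; have c0 : c != 0%R by apply: contraNneq A0 => <-.
apply: (@leq_card_fset _ _ (fun x => x * c)%R) => [a b _ _|x]; first exact: mulIf.
exact: popdiff_mul.
Qed.

(** The multiples x c are distinct because x is nonzero. This lower bound serves to check the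
    hypotheses of [incidences_cube]. *)
Lemma leq_card_popdiff_orbit A P s x : 0 < s -> 0%R \notin A ->
  x \in popdiff P s -> #|` A| <= #|` popdiff (mulfset A P) s|.
Proof.
move=> s0 A0 xD; apply: (@leq_card_fset _ _ (fun c => x * c)%R).
  by move=> a b _ _; apply/mulfI/(popdiff_neq0 xD).
by move=> c cA; exact: popdiff_mul.
Qed.

End PopularDifferences.

(* In the applications a solution t of an additive equation gives, after
   multiplication by c in A, a line through a point of abscissa 1/c. *)
Lemma incidences_ge (R : realFieldType) (U : choiceType) (A Y : {fset R})
    (S : {fset R * R}) (T : {fset U}) (line : R -> U -> R * R) :
  (forall c, c \in A -> {in T &, injective (line c)}) ->
  (forall c t, c \in A -> t \in T ->
    line c t \in S /\ ((line c t).1 / c + (line c t).2)%R \in Y) ->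
  #|` A| * #|` T| <= incidences [fset c^-1%R | c in A] Y S.
Proof.
move=> injl lineP; rewrite /incidences exchange_big /= big_imfset /=; last first.
  by move=> a b _ _; apply: invr_inj.
rewrite -[#|` A|]sum1_size big_distrl /= big_seq [leqRHS]big_seq.
apply: leq_sum => c cA; rewrite mul1n -card_fset_sum.
apply: (leq_card_fset (injl c cA)) => t tT; rewrite !inE /=.
by have [-> ->] := lineP c t cA tT.
Qed.

(** * Popular differences of a set with few products *)

Section SmallProductSet.
Context {R : realFieldType} (A : {fset R}) (m : nat).
Hypotheses (A0 : 0%R \notin A) (An : A != fset0).
Hypothesis AAm : #|` mulfset A A| <= m * #|` A|.

Let N := #|` A|.
Let N0 : 0 < N. Proof. by rewrite cardfs_gt0. Qed.
Let Ak k : #|` powfset A k| <= m ^ k * N.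
Proof. exact: card_powfset. Qed.

Let m0 : 0 < m.
Proof.
have /fset0Pn[a aA] := An.
have /leq_trans/(_ AAm) : 0 < #|` mulfset A A|.
  by rewrite cardfs_gt0; apply/fset0Pn; exists (a * a)%R; rewrite mem_mulfset.
by rewrite muln_gt0 => /andP[].
Qed.

Let card_inv : #|` [fset c^-1%R | c in A]| = N.
Proof. by rewrite card_in_imfset // => a b _ _; apply: invr_inj. Qed.

Let N_le_pow k : N <= #|` powfset A k.+1|.
Proof.
rewrite powfsetS mulfsetC; apply: leq_card_mulfset.
have : powfset A k != fset0.
  elim: k => [|k /fset0Pn[x xk]]; first by apply/fset0Pn; exists 1%R; rewrite inE.
  have /fset0Pn[a aA] := An; apply/fset0Pn; exists (a * x)%R.
  by rewrite powfsetS mem_mulfset.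
case/fset0Pn => x xk; exists x => //.
by apply: contraNneq (powfset_neq0 k A0) => <-.
Qed.

(* If x = p - q then, for every c in A, the point (1/c, x) lies on the line of
   slope p c and intercept - q. *)
Lemma card_popdiff3 s : 0 < s ->
  #|` popdiff (powfset A 3) s| * s ^ 3 <= incidence_const * m ^ 62 * N ^ 3.
Proof.
move=> s0; set Y := popdiff _ s; pose X := [fset c^-1%R | c in A].
have triv : s * #|` Y| <= m ^ 6 * N ^ 2.
  apply: (leq_trans (card_popdiff_le _ _)).
  by rewrite (_ : m ^ 6 * N ^ 2 = (m ^ 3 * N) ^ 2) ?leq_exp2r ?Ak //; ring.
(* For small s the count of pairs in [triv] already suffices. *)
case: (leqP (s ^ 2) N) => sN.
  apply: (@leq_trans ((s * #|` Y|) * s ^ 2)); first by rewrite (_ : _ * s ^ 3 = s * #|` Y| * s ^ 2) //; ring.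
  apply: (leq_trans (leq_mul triv sN)).
  rewrite (_ : _ * N = 1 * m ^ 6 * N ^ 3); last by ring.
  by rewrite leq_mul2r leq_mul ?orbT ?leq_pexp2l ?incidence_const_gt0.
have [->|Y0] := posnP #|` Y|; first by rewrite mul0n.
pose S := powfset A 4 `*` [fset (- p)%R | p in powfset A 3].
have cardN : #|` [fset (- p)%R | p in powfset A 3]| = #|` powfset A 3|.
  by rewrite card_in_imfset // => a b _ _; apply: oppr_inj.
have cardS : #|` S| = #|` powfset A 4| * #|` powfset A 3|.
  by rewrite card_fsetM cardN.
have S_ge : N ^ 2 <= #|` S| by rewrite cardS -mulnn leq_mul ?N_le_pow.
have S_le : #|` S| <= m ^ 7 * N ^ 2.
  rewrite cardS (_ : _ * N ^ 2 = (m ^ 4 * N) * (m ^ 3 * N)); last by ring.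
  by rewrite leq_mul ?Ak.
have I_ge : N * (s * #|` Y|) <= incidences X Y S.
  apply: (@leq_trans (N * #|` popdiff_pairs (powfset A 3) s|)).
    by rewrite leq_mul2l card_popdiff_pairs orbT.
  apply: (@incidences_ge R _ A Y S _ (fun c t => (c * t.1, - t.2)%R)) => [c cA|c t cA].
    have c0 : c != 0%R by apply: contraNneq A0 => <-.
    by move=> [p q] [p' q'] _ _ /= [/(mulfI c0) -> /oppr_inj ->].
  have c0 : c != 0%R by apply: contraNneq A0 => <-.
  rewrite in_fset_sep in_fsetM => /andP[/andP[t1 t2] tY]; split.
    by rewrite in_fsetM /= powfsetS mem_mulfset //=; apply/imfsetP; exists t.2.
  by rewrite /= mulrAC mulfV // mul1r.
(* Since N < s^2, [triv] bounds |Y|^2 well enough for the incidence bound to apply with lam =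
   m^12. *)
have Y_le : #|` Y| ^ 2 <= m ^ 12 * N ^ 3.
  rewrite -(leq_pmul2r N0); apply: (@leq_trans ((s * #|` Y|) ^ 2)).
    by rewrite expnMn mulnC leq_mul2r ltnW ?orbT.
  apply: (@leq_trans ((m ^ 6 * N ^ 2) ^ 2)); first by rewrite leq_exp2r.
  by rewrite (_ : _ ^ 2 = m ^ 12 * N ^ 3 * N) //; ring.
have I_le : incidences X Y S ^ 3 <=
    incidence_const * (m ^ 12) ^ 4 * (N * #|` Y|) ^ 2 * #|` S| ^ 2.
  rewrite -card_inv; apply: incidences_cube; rewrite card_inv -/N.
  - rewrite expnMn mulnC.
    apply: (@leq_trans (m ^ 12 * N ^ 3 * N ^ 2)); first by rewrite leq_mul2r Y_le orbT.
    rewrite (_ : _ * N ^ 2 = m ^ 12 * N ^ 2 * N ^ 3); last by ring.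
    by rewrite leq_mul // leq_mul.
  - rewrite expnMn; apply: leq_mul; last by rewrite leq_pexp2l.
    by rewrite (leq_trans S_ge) // leq_pmull ?expn_gt0 ?m0.
  - apply: (leq_trans S_le); rewrite expnMn.
    apply: leq_mul; first by rewrite leq_pexp2l.
    by rewrite leq_pmulr ?expn_gt0 ?Y0.
have H : (N * (s * #|` Y|)) ^ 3 <= incidence_const * (m ^ 12) ^ 4 * (N * #|` Y|) ^ 2 * (m ^ 7 * N ^ 2) ^ 2.
  apply: (@leq_trans (incidences X Y S ^ 3)); first by rewrite leq_exp2r.
  by apply: (leq_trans I_le); rewrite leq_mul2l leq_exp2r ?S_le ?orbT.
have NY : 0 < N ^ 3 * #|` Y| ^ 2 by rewrite muln_gt0 !expn_gt0 N0 Y0.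
rewrite -(leq_pmul2l NY).
rewrite [leqLHS](_ : _ = (N * (s * #|` Y|)) ^ 3); last by ring.
by apply: (leq_trans H); rewrite eq_leq //; ring.
Qed.

Let D j s := popdiff (powfset A j) s.

Let D_step j s : 0 < s -> #|` D j s| <= #|` D j.+1 s|.
Proof. by move=> s0; rewrite /D powfsetS leq_card_popdiff_mul. Qed.

Let N_le_D2 s : 0 < s -> D 1 s != fset0 -> N <= #|` D 2 s|.
Proof. by move=> s0 /fset0Pn[x xD]; rewrite /D powfsetS (leq_card_popdiff_orbit s0 A0 xD). Qed.

Let D_triv j s : 0 < s -> #|` D j s| <= m ^ (2 * j) * N ^ 2.
Proof.
move=> s0; apply: (@leq_trans (s * #|` D j s|)); first by rewrite leq_pmull.
apply: (leq_trans (card_popdiff_le _ _)).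
by rewrite (mulnC 2) expnM -expnMn leq_exp2r ?Ak.
Qed.

Let D_cube s : 0 < s -> #|` D 2 s| * s ^ 3 <= incidence_const * m ^ 62 * N ^ 3.
Proof.
move=> s0; apply: leq_trans (card_popdiff3 s0).
by rewrite leq_mul2r (D_step 2 s0) orbT.
Qed.

(** If b - b' = d is popular then, for every c in A, the line of slope d c and intercept b' passes
    through (1/c, b), so each pair yields N incidences with a grid whose ordinates are B. The two
    size hypotheses bring this grid into the range of [incidences_cube]. *)
Lemma card_pairs_popdiff (B : {fset R}) s : 0 < s ->
  N <= #|` B| ^ 2 -> #|` B| <= N ^ 2 ->
  (#|` [fset t in B `*` B | (t.1 - t.2)%R \in popdiff (powfset A 1) s]| * s ^ 2) ^ 3
    <= incidence_const ^ 3 * m ^ 140 * #|` B| ^ 4 * N ^ 5.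
Proof.
move=> s0 NB BN; set T := [fset t in B `*` B | _]; set n := #|` B| in NB BN *.
have [->|T0] := posnP #|` T|; first by rewrite mul0n.
have D1 : D 1 s != fset0.
  move: T0; rewrite cardfs_gt0 => /fset0Pn[t].
  by rewrite in_fset_sep => /andP[_ tD]; apply/fset0Pn; eexists; exact: tD.
have ND := N_le_D2 s0 D1; set d := #|` D 2 s| in ND.
have n0 : 0 < n by move: NB; case: (n) => //; rewrite leqNgt N0.
pose S := D 2 s `*` B; pose X := [fset c^-1%R | c in A].
have cardS : #|` S| = d * n by rewrite card_fsetM.
have I_ge : N * #|` T| <= incidences X B S.
  apply: (@incidences_ge R _ A B S T (fun c t => ((t.1 - t.2) * c, t.2)%R)) => [c cA|c t cA].
    have c0 : c != 0%R by apply: contraNneq A0 => <-.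
    by move=> [p q] [p' q'] _ _ /= [/(mulIf c0) e e']; move: e; rewrite e' => /(@addIr _ _ _ _) ->.
  have c0 : c != 0%R by apply: contraNneq A0 => <-.
  rewrite in_fset_sep in_fsetM => /andP[/andP[t1 t2] tY]; split.
    by rewrite in_fsetM t2 andbT /D powfsetS popdiff_mul.
  by rewrite /= mulfK // subrK.
have mN k : 0 < m ^ k by rewrite expn_gt0 m0.
have I_le : incidences X B S ^ 3 <=
    incidence_const * (m ^ 4) ^ 4 * (N * n) ^ 2 * (d * n) ^ 2.
  rewrite -card_inv -cardS; apply: incidences_cube; rewrite card_inv cardS -/N -/n.
  - rewrite (_ : (N * n) ^ 2 = 1 * (n * n) * (N ^ 2)); last by ring.
    rewrite (_ : _ * N ^ 3 = m ^ 4 * (n * (d * N)) * N ^ 2); last by ring.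
    rewrite leq_mul // leq_mul // leq_mul // (leq_trans BN) //.
    by rewrite -mulnn leq_mul.
  - rewrite (_ : (N * n) ^ 2 = 1 * (N * N) * (n ^ 2)); last by ring.
    rewrite (_ : _ * n ^ 3 = m ^ 4 * (d * n ^ 2) * n ^ 2); last by ring.
    by rewrite leq_mul // leq_mul // leq_mul.
  - apply: (@leq_trans (m ^ 4 * N ^ 2 * n)); first by rewrite leq_mul2r (D_triv 2 s0) orbT.
    rewrite (_ : m ^ 4 * (N * n) ^ 2 = m ^ 4 * N ^ 2 * n * n); last by ring.
    by rewrite leq_pmulr.
have H1 : N * #|` T| ^ 3 <= incidence_const * m ^ 16 * n ^ 4 * d ^ 2.
  have N2 : 0 < N ^ 2 by rewrite expn_gt0 N0.
  rewrite -(leq_pmul2l N2).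
  apply: (@leq_trans (incidences X B S ^ 3)).
    by rewrite (_ : N ^ 2 * _ = (N * #|` T|) ^ 3) ?leq_exp2r //; ring.
  by apply: (leq_trans I_le); rewrite eq_leq //; ring.
have H2 : (d * s ^ 3) ^ 2 <= (incidence_const * m ^ 62 * N ^ 3) ^ 2 by rewrite leq_exp2r ?D_cube.
have dN : 0 < d ^ 2 * N by rewrite muln_gt0 expn_gt0 (leq_trans N0 ND).
rewrite -(leq_pmul2l dN).
rewrite [leqLHS](_ : _ = (N * #|` T| ^ 3) * (d * s ^ 3) ^ 2); last by ring.
by apply: (leq_trans (leq_mul H1 H2)); rewrite eq_leq //; ring.
Qed.

(* The assumption that s3 is the largest threshold makes the set of abscissas
   of the incidence problem long enough compared with the set of ordinates. *)
Lemma card_popdiff_sums s1 s2 s3 : 0 < s1 -> 0 < s2 -> s1 <= s3 -> s2 <= s3 ->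
  popdiff (powfset A 1) s3 != fset0 ->
  N * #|` [fset e in popdiff (powfset A 2) s1 `*` popdiff (powfset A 2) s2 |
            (e.1 + e.2)%R \in popdiff (powfset A 2) s3]| ^ 3 * (s1 * s2 * s3) ^ 6
    <= incidence_const ^ 7 * m ^ 412 * N ^ 18.
Proof.
move=> s10 s20 s13 s23 D13; have s30 := leq_trans s10 s13.
rewrite -!/(D 2 _); set T := [fset e in _ | _].
have D1_ne s : s <= s3 -> D 1 s != fset0.
  case/fset0Pn: D13 => x xD ss; apply/fset0Pn; exists x.
  exact: (fsubsetP (popdiff_le _ ss)).
have N1 := N_le_D2 s10 (D1_ne _ s13); have N2 := N_le_D2 s20 (D1_ne _ s23).
have N3 := N_le_D2 s30 D13.
have d31 := fsubset_leq_card (popdiff_le (powfset A 2) s13).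
have d32 := fsubset_leq_card (popdiff_le (powfset A 2) s23).
have d1' := D_step 2 s10.
have d1_cube : #|` D 3 s1| * s1 ^ 3 <= incidence_const * m ^ 62 * N ^ 3 by exact: card_popdiff3.
have d2_cube := D_cube s20; have d3_cube := D_cube s30.
have d1_triv := D_triv 3 s10; have d2_triv := D_triv 2 s20.
(* A relation e1 + e2 = e3 gives, for every c in A, a line of slope e1 c and intercept e2 through
   (1/c, e3). *)
pose S := D 3 s1 `*` D 2 s2; pose X := [fset c^-1%R | c in A].
have cardS : #|` S| = #|` D 3 s1| * #|` D 2 s2| by rewrite card_fsetM.
have I_ge : N * #|` T| <= incidences X (D 2 s3) S.
  apply: (@incidences_ge R _ A (D 2 s3) S T (fun c t => (t.1 * c, t.2)%R)) => [c cA|c t cA].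
    have c0 : c != 0%R by apply: contraNneq A0 => <-.
    by move=> [p q] [p' q'] _ _ /= [/(mulIf c0) -> ->].
  have c0 : c != 0%R by apply: contraNneq A0 => <-.
  rewrite in_fset_sep in_fsetM => /andP[/andP[t1 t2] tY]; split.
    by rewrite in_fsetM t2 andbT /D powfsetS popdiff_mul.
  by rewrite /= mulfK.
move: N1 N2 N3 d31 d32 d1' d1_cube d2_cube d3_cube d1_triv d2_triv cardS.
rewrite -!/(D 2 _).
set d1 := #|` D 3 s1|; set d2 := #|` D 2 s2|; set d3 := #|` D 2 s3|.
move=> N1 N2 N3 d31 d32 d1' d1_cube d2_cube d3_cube d1_triv d2_triv cardS.
have mN k : 0 < m ^ k by rewrite expn_gt0 m0.
have I_le : incidences X (D 2 s3) S ^ 3 <=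
    incidence_const * (m ^ 10) ^ 4 * (N * d3) ^ 2 * (d1 * d2) ^ 2.
  rewrite -card_inv -cardS; apply: incidences_cube; rewrite card_inv cardS -/N -/d3.
  - rewrite (_ : (N * d3) ^ 2 = 1 * (d3 * d3) * 1 * (N ^ 2)); last by ring.
    rewrite (_ : _ * N ^ 3 = m ^ 10 * (d1 * d2) * N * N ^ 2); last by ring.
    by rewrite leq_mul // leq_mul // leq_mul // leq_mul // (leq_trans d31).
  - rewrite (_ : (N * d3) ^ 2 = 1 * (N * N) * 1 * (d3 ^ 2)); last by ring.
    rewrite (_ : _ * d3 ^ 3 = m ^ 10 * (d1 * d2) * d3 * d3 ^ 2); last by ring.
    rewrite leq_mul // leq_mul ?(leq_trans N0 N3) // leq_mul // leq_mul //.
    by rewrite (leq_trans N3) // (leq_trans d31).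
  - apply: (leq_trans (leq_mul d1_triv d2_triv)).
    rewrite (_ : _ * _ = m ^ 10 * (N * N) ^ 2); last by ring.
    by rewrite leq_mul // leq_exp2r // leq_mul.
have H1 : N * #|` T| ^ 3 <= incidence_const * m ^ 40 * (d1 * d2 * d3) ^ 2.
  have N20 : 0 < N ^ 2 by rewrite expn_gt0 N0.
  rewrite -(leq_pmul2l N20).
  apply: (@leq_trans (incidences X (D 2 s3) S ^ 3)).
    by rewrite (_ : N ^ 2 * _ = (N * #|` T|) ^ 3) ?leq_exp2r //; ring.
  by apply: (leq_trans I_le); rewrite eq_leq //; ring.
have H2 : (d1 * d2 * d3 * (s1 * s2 * s3) ^ 3) ^ 2 <= ((incidence_const * m ^ 62 * N ^ 3) ^ 3) ^ 2.
  rewrite leq_exp2r // (_ : d1 * d2 * d3 * _ =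
    d1 * s1 ^ 3 * (d2 * s2 ^ 3) * (d3 * s3 ^ 3)); last by ring.
  rewrite [leqRHS](_ : _ = (incidence_const * m ^ 62 * N ^ 3) * (incidence_const * m ^ 62 * N ^ 3)
    * (incidence_const * m ^ 62 * N ^ 3)); last by ring.
  by rewrite leq_mul // leq_mul.
have d0 : 0 < (d1 * d2 * d3) ^ 2.
  by rewrite expn_gt0 !muln_gt0 !(leq_trans N0) // (leq_trans N1).
rewrite -(leq_pmul2l d0).
rewrite [leqLHS](_ : _ = (N * #|` T| ^ 3) * (d1 * d2 * d3 * (s1 * s2 * s3) ^ 3) ^ 2);
  last by ring.
by apply: (leq_trans (leq_mul H1 H2)); rewrite eq_leq //; ring.
Qed.

End SmallProductSet.

(** * Collinear triples *)

Section LayerCake.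
Context {R : realFieldType}.

Definition harmonic_sum n : R := (\sum_(1 <= s < n.+1) s%:R^-1)%R.

Lemma harmonic_sum_ge0 n : (0 <= harmonic_sum n)%R.
Proof. by apply: sumr_ge0 => s _; rewrite invr_ge0 ler0n. Qed.

Lemma expSn_le f k : f.+1 ^ k.+1 <= f ^ k.+1 + k.+1 * f.+1 ^ k.
Proof.
elim: k => [|k IHk]; first by rewrite !expn1 expn0 muln1 addn1.
rewrite expnS mulSn (mulSn k.+1) addnCA leq_add2l.
apply: (leq_trans (leq_mul (leqnn f) IHk)).
rewrite mulnDr -expnS leq_add2l mulnCA leq_mul2l /=.
by rewrite expnS leq_mul2r leqnSn orbT.
Qed.

Lemma expn_le_layers f k : f ^ k.+1 <= \sum_(1 <= s < f.+1) k.+1 * s ^ k.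
Proof.
elim: f => [|f IHf]; first by rewrite exp0n.
by rewrite big_nat_recr //= (leq_trans (expSn_le f k)) // leq_add2r.
Qed.

(** Each power is at most a sum of (k + 1) s^k over the levels s <= f t. After exchanging the sums,
    the tail bound leaves (k + 1) K / s at level s. *)
Lemma sum_expr_layers (T : choiceType) (S : {fset T}) (f : T -> nat) n k (K : R) :
  (forall t, t \in S -> f t <= n) ->
  (forall s, 0 < s -> (#|` [fset t in S | (s <= f t)%N]|%:R * s%:R ^+ k.+1 <= K)%R) ->
  (\sum_(t <- S) (f t)%:R ^+ k.+1 <= k.+1%:R * K * harmonic_sum n)%R.
Proof.
move=> fn tail.
apply: (@le_trans _ _ (\sum_(t <- S) \sum_(1 <= s < n.+1)
    k.+1%:R * s%:R ^+ k * (s <= f t)%N%:R)%R).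
  rewrite big_seq [leRHS]big_seq; apply: ler_sum => t tS.
  rewrite (big_cat_nat (n := (f t).+1)) ?ltnS ?fn //= -[leLHS]addr0 lerD //.
    rewrite -natrX; apply: (le_trans (_ : _ <= (\sum_(1 <= s < (f t).+1) k.+1 * s ^ k)%N%:R)%R).
      by rewrite ler_nat expn_le_layers.
    rewrite natr_sum big_nat [leRHS]big_nat; apply: ler_sum => s /andP[_ sf].
    by rewrite -ltnS sf mulr1 natrM natrX.
  by apply: sumr_ge0 => s _; rewrite !mulr_ge0 ?exprn_ge0 ?ler0n.
rewrite exchange_big /= /harmonic_sum big_distrr /= big_nat [leRHS]big_nat.
apply: ler_sum => s /andP[s0 _]; rewrite -big_distrr /= -natr_sum -card_fset_sum.
have s0' : (0 < s%:R :> R)%R by rewrite ltr0n.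
rewrite ler_pdivlMr // -!mulrA ler_wpM2l ?ler0n // mulrC -mulrA -exprS.
exact: tail.
Qed.

End LayerCake.

Section RichLines.
Context {R : realFieldType} (B : {fset R}).

Definition line_count (l : R * R) := \sum_(x <- B) ((l.1 * x + l.2)%R \in B : nat).

Lemma line_count_le l : line_count l <= #|` B|.
Proof. by rewrite -sum1_size; apply: leq_sum => x _; case: (_ \in _). Qed.

(** The rich lines carry at least s incidences each with B x B, and the incidence bound applies with
    lam = 1 once there are at least |B| of them. With fewer lines, s <= |B| is enough. *)
Lemma rich_lines (S : {fset R * R}) s : 0 < s -> #|` S| <= #|` B| ^ 4 ->
  #|` [fset l in S | s <= line_count l]| * s ^ 3 <= incidence_const * #|` B| ^ 4.
Proof.
move=> s0 Sn; set T := [fset l in S | _]; set n := #|` B|.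
have [->|T0] := posnP #|` T|; first by rewrite mul0n.
have sn : s <= n.
  move: T0; rewrite cardfs_gt0 => /fset0Pn[l]; rewrite in_fset_sep => /andP[_ sl].
  exact: leq_trans (line_count_le l).
have I_ge : s * #|` T| <= incidences B B T.
  rewrite mulnC -sum1_size big_distrl /= big_seq [leqRHS]big_seq; apply: leq_sum => l.
  by rewrite in_fset_sep mul1n => /andP[].
case: (leqP n #|` T|) => Tn; last first.
  apply: (@leq_trans (n * n ^ 3)); first by rewrite leq_mul ?(ltnW Tn) ?leq_exp2r.
  by rewrite -expnS leq_pmull ?incidence_const_gt0.
have TS : #|` T| <= n ^ 4.
  apply: leq_trans Sn; apply/fsubset_leq_card/fsubsetP => l.
  by rewrite in_fset_sep => /andP[].
have I_le : incidences B B T ^ 3 <= incidence_const * 1 ^ 4 * (n * n) ^ 2 * #|` T| ^ 2.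
  have H : (n * n) ^ 2 <= 1 * #|` T| * n ^ 3.
    by rewrite mul1n (_ : _ ^ 2 = n * n ^ 3) ?leq_mul //; ring.
  apply: incidences_cube => //.
  by rewrite mul1n (_ : _ ^ 2 = n ^ 4) //; rewrite /n; ring.
have T2 : 0 < #|` T| ^ 2 by rewrite expn_gt0 T0.
rewrite -(leq_pmul2l T2); apply: (@leq_trans (incidences B B T ^ 3)).
  by rewrite (_ : _ * _ = (s * #|` T|) ^ 3) ?leq_exp2r //; ring.
by apply: (leq_trans I_le); rewrite eq_leq //; ring.
Qed.

(** The sum counts ordered triples of points of B x B on a common line of [S]; summing [rich_lines]
    over the levels costs the harmonic factor. *)
Lemma sum_line_count_cube (S : {fset R * R}) : #|` S| <= #|` B| ^ 4 ->
  (\sum_(l <- S) (line_count l)%:R ^+ 3 <=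
     3 * (incidence_const * #|` B| ^ 4)%:R * harmonic_sum #|` B| :> R)%R.
Proof.
move=> Sn; apply: sum_expr_layers => [l _|s s0]; first exact: line_count_le.
by rewrite -natrX -natrM ler_nat rich_lines.
Qed.

End RichLines.

(** * The trace of the cube of a Gram matrix *)

Section Trace.
Local Open Scope ring_scope.

(** Lagrange's identity: twice the difference of the two sides is a double sum of squares. *)
Lemma cauchy_schwarz_sum (R : realDomainType) (T : Type) (s : seq T) (f g : T -> R) :
  (\sum_(i <- s) f i * g i) ^+ 2 <= (\sum_(i <- s) f i ^+ 2) * (\sum_(i <- s) g i ^+ 2).
Proof.
have : 0 <= \sum_(i <- s) \sum_(j <- s) (f i * g j - f j * g i) ^+ 2.
  by apply: sumr_ge0 => i _; apply: sumr_ge0 => j _; exact: sqr_ge0.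
rewrite [X in 0 <= X](_ : _ = ((\sum_(i <- s) f i ^+ 2) * (\sum_(i <- s) g i ^+ 2)
   - (\sum_(i <- s) f i * g i) ^+ 2) *+ 2); first by rewrite pmulrn_lge0 // subr_ge0.
rewrite expr2 !big_distrlr /= -sumrB mulr2n.
have -> : \sum_(i <- s) \sum_(j <- s) (f i * g j - f j * g i) ^+ 2 =
  \sum_(i <- s) \sum_(j <- s) (f i ^+ 2 * g j ^+ 2 - f i * g i * (f j * g j)) +
  \sum_(i <- s) \sum_(j <- s) (f j ^+ 2 * g i ^+ 2 - f i * g i * (f j * g j)).
  rewrite -big_split; apply: eq_bigr => i _; rewrite -big_split; apply: eq_bigr => j _ /=.
  by ring.
congr (_ + _); first by apply: eq_bigr => i _; rewrite sumrB.
by rewrite exchange_big /=; apply: eq_bigr => i _; rewrite -sumrB; apply: eq_bigr => j _; ring.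
Qed.

Context {R : realFieldType} {U T : eqType} (X : seq U) (B : seq T) (u : U -> T -> R) (N : R).

(** For the matrix U with entries [u x b] this is K = U^T U, and K' below is K with its diagonal
    removed. In the application K has entries r(b - b') and diagonal |A|. *)
Definition gram b b' := \sum_(x <- X) u x b * u x b'.
Definition offdiag_gram b b' := if b == b' then 0 else gram b b'.
Local Notation k := gram.
Local Notation k' := offdiag_gram.

Lemma gramC b b' : gram b b' = gram b' b.
Proof. by apply: eq_bigr => x _; rewrite mulrC. Qed.

Lemma offdiag_gramC b b' : offdiag_gram b b' = offdiag_gram b' b.
Proof. by rewrite /offdiag_gram eq_sym gramC. Qed.

Hypothesis (uB : uniq B) (diag : forall b, b \in B -> gram b b = N).

Let sum_gram (F : T -> R) b : b \in B ->
  \sum_(b' <- B) F b' * k b b' = \sum_(b' <- B) F b' * k' b b' + F b * N.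
Proof.
move=> bB; rewrite (big_rem b) //= [in RHS](big_rem b) //= {1}/k' eqxx mulr0 add0r.
rewrite diag // addrC; congr (_ + _).
rewrite big_seq [RHS]big_seq; apply: eq_bigr => c.
by rewrite rem_filter // mem_filter /= /offdiag_gram eq_sym => /andP[/negPf->].
Qed.

(* The spectral bound (largest eigenvalue)^3 <= trace is replaced by testing
   K' K K' on the constant vector.  The hypothesis on E makes the diagonal of the
   Gram matrix K negligible. *)
Lemma offdiag_gram_trace :
  let E := \sum_(b <- B) \sum_(b' <- B) k b b' in
  2 * N * (size B)%:R <= E ->
  E ^+ 3 <= 4 * (size B)%:R ^+ 3 *
    (\sum_(a <- B) \sum_(b <- B) \sum_(c <- B) k' a b * k' b c * k' a c
     + N * \sum_(a <- B) \sum_(b <- B) k' a b ^+ 2).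
Proof.
move=> E NE; set Q := (_ + N * _); set n := (size B)%:R in NE *.
pose row b := \sum_(b' <- B) k b b'.
pose row' b := \sum_(b' <- B) k' b b'.
have rowE b : b \in B -> row b = row' b + N.
  move=> bB; have := sum_gram (fun=> 1) bB; rewrite mul1r.
  by under eq_bigr do rewrite mul1r; under [X in _ = X + _]eq_bigr do rewrite mul1r.
(* In matrix form g = U 1, h = U K' and hs = U K' 1. Thus E is the squared norm of g, and W below is
   the inner product of hs and g. *)
pose g x := \sum_(b <- B) u x b.
pose h x b := \sum_(b' <- B) k' b b' * u x b'.
pose hs x := \sum_(b <- B) h x b.
have sum1n : \sum_(b <- B) (1 : R) ^+ 2 = n.
  by rewrite expr1n big_const_seq count_predT iter_addr_0.
have Eg : \sum_(x <- X) g x ^+ 2 = E.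
  rewrite /E; under eq_bigr do rewrite expr2 big_distrlr /=.
  rewrite exchange_big /=; apply: eq_bigr => b _.
  by rewrite exchange_big.
have hsE x : hs x = \sum_(b <- B) row' b * u x b.
  rewrite /hs /h exchange_big /=; apply: eq_bigr => b _; rewrite -big_distrl /=.
  by congr (_ * _); apply: eq_bigr => b' _; rewrite offdiag_gramC.
have hg : \sum_(x <- X) hs x * g x = \sum_(b <- B) row' b * row b.
  under eq_bigr do rewrite hsE big_distrl /=.
  rewrite exchange_big /=; apply: eq_bigr => b _.
  under eq_bigr do rewrite -mulrA; rewrite -big_distrr /=; congr (_ * _).
  under eq_bigr do rewrite big_distrr /=.
  by rewrite exchange_big.
pose W := \sum_(b <- B) row' b * row b.
have WE : W = \sum_(b <- B) row b ^+ 2 - N * E.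
  rewrite /E big_distrr /= -sumrB /W big_seq [RHS]big_seq; apply: eq_bigr => b bB.
  by rewrite -/(row b) rowE //; ring.
have E2 : E ^+ 2 <= n * \sum_(b <- B) row b ^+ 2.
  rewrite -sum1n; apply: le_trans (cauchy_schwarz_sum _ _ _).
  by rewrite (_ : E = \sum_(b <- B) 1 * row b) //; apply: eq_bigr => b _; rewrite mul1r.
have W2 : W ^+ 2 <= (\sum_(x <- X) hs x ^+ 2) * E.
  by rewrite /W -hg -Eg; exact: cauchy_schwarz_sum.
have hs2 : \sum_(x <- X) hs x ^+ 2 <= n * \sum_(x <- X) \sum_(b <- B) h x b ^+ 2.
  rewrite big_distrr /=; apply: ler_sum => x _; rewrite -sum1n.
  apply: le_trans (cauchy_schwarz_sum _ _ _).
  by rewrite (_ : hs x = \sum_(b <- B) 1 * h x b) //; apply: eq_bigr => b _; rewrite mul1r.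
(* This is the trace of K' K K', and K = K' + N I on [B] splits it into the two terms of Q. *)
have hQ : \sum_(x <- X) \sum_(b <- B) h x b ^+ 2 = Q.
  rewrite exchange_big /= /Q big_distrr /= -big_split /=; apply: eq_bigr => a _.
  transitivity (\sum_(b <- B) k' a b * \sum_(c <- B) k' a c * k b c).
    under eq_bigr do rewrite expr2 big_distrlr /=.
    rewrite exchange_big /=; apply: eq_bigr => b _.
    rewrite exchange_big big_distrr /=; apply: eq_bigr => c _.
    by rewrite /gram !big_distrr /=; apply: eq_bigr => x _; ring.
  rewrite big_distrr /= -big_split /= big_seq [RHS]big_seq; apply: eq_bigr => b bB.
  rewrite sum_gram // mulrDr big_distrr /=; congr (_ + _); last by ring.
  by apply: eq_bigr => c _; ring.
rewrite hQ in hs2.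
have n0 : 0 <= n by rewrite ler0n.
have E0 : 0 <= E by rewrite -Eg; apply: sumr_ge0 => x _; exact: sqr_ge0.
have Q0 : 0 <= Q.
  by rewrite -hQ; apply: sumr_ge0 => x _; apply: sumr_ge0 => b _; exact: sqr_ge0.
have [E00|Epos] := eqVneq E 0.
  by rewrite E00 expr0n /= !mulr_ge0 ?exprn_ge0.
have {E0 Epos}E0 : 0 < E by rewrite lt_neqAle eq_sym Epos.
have W2Q : W ^+ 2 <= n * Q * E by apply: le_trans W2 _; rewrite ler_wpM2r // ltW.
(* By Cauchy-Schwarz n W >= E^2 - n N E, and the assumption on E bounds the subtracted term by half
   of E^2. *)
have nW : E ^+ 2 / 2 <= n * W.
  rewrite WE mulrBr; have : 2 * N * n * E <= E * E by rewrite ler_wpM2r // ltW.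
  by nra.
have H : (E ^+ 2 / 2) ^+ 2 <= n ^+ 2 * (n * Q * E).
  apply: le_trans (ler_wpM2l (exprn_ge0 2 n0) W2Q); rewrite -exprMn.
  have E20 : 0 <= E ^+ 2 / 2 by rewrite divr_ge0 ?exprn_ge0 // ltW.
  by rewrite ler_pXn2r // nnegrE // (le_trans E20).
rewrite -(ler_pM2r E0).
rewrite [leLHS](_ : _ = 4 * (E ^+ 2 / 2) ^+ 2); last by field.
rewrite [leRHS](_ : _ = 4 * (n ^+ 2 * (n * Q * E))); last by ring.
by rewrite ler_wpM2l.
Qed.

End Trace.

(** * Triangles of popular differences *)

(** Cauchy-Schwarz for the fibre sizes, which sum to |P| and whose squares sum to the number of
    collisions. *)
Lemma card_sqr_le_collisions (T U : choiceType) (f : T -> U) (P : {fset T}) (Q : {fset U}) :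
  (forall x, x \in P -> f x \in Q) ->
  #|` P| ^ 2 <= #|` Q| * #|` [fset t in P `*` P | f t.1 == f t.2]|.
Proof.
move=> fPQ; pose c q := \sum_(x <- P) (f x == q : nat).
have one x : x \in P -> \sum_(q <- Q) (f x == q : nat) = 1.
  move=> xP; rewrite (big_rem (f x)) ?fPQ //= eqxx big_seq big1 ?addn0 // => q.
  by rewrite rem_filter ?fset_uniq // mem_filter /= eq_sym => /andP[/negPf->].
have sumc : \sum_(q <- Q) c q = #|` P|.
  rewrite /c exchange_big /= -sum1_size big_seq [RHS]big_seq.
  by apply: eq_bigr => x /one.
have sumc2 : \sum_(q <- Q) c q ^ 2 = #|` [fset t in P `*` P | f t.1 == f t.2]|.
  rewrite card_fset_sum big_fsetM /=.
  under eq_bigr do rewrite -mulnn big_distrlr /=.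
  rewrite exchange_big /= big_seq [RHS]big_seq; apply: eq_bigr => x xP.
  rewrite exchange_big /=; apply: eq_bigr => y _.
  rewrite -[RHS]mul1n -(one x xP) big_distrl /=; apply: eq_bigr => q _.
  by case: (eqVneq (f x) q) => [->|]; rewrite ?mul0n // eq_sym.
rewrite -sumc2 -sumc -(ler_nat int) natrM natrX !natr_sum.
under eq_bigr do rewrite -[(_%:R)%R]mul1r.
apply: (le_trans (cauchy_schwarz_sum _ _ _)).
rewrite expr1n big_const_seq count_predT iter_addr_0.
by rewrite ler_wpM2l ?ler0n // le_eqVlt; apply/orP; left; apply/eqP; apply: eq_bigr => q _; rewrite natrX.
Qed.

Section Triangles.
Context {R : realFieldType} (A B : {fset R}) (m : nat).
Hypotheses (A0 : 0%R \notin A) (An : A != fset0).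
Hypothesis AAm : #|` mulfset A A| <= m * #|` A|.

Definition popular_triangles s1 s2 s3 :=
  [fset t in (B `*` B) `*` B |
    [&& (t.1.1 - t.1.2)%R \in popdiff (powfset A 1) s1,
        (t.1.2 - t.2)%R \in popdiff (powfset A 1) s2 &
        (t.1.1 - t.2)%R \in popdiff (powfset A 1) s3]].

(** For t = ((x, y), (x', y')) with x' != y', the graph of the affine map taking x' to x and y' to
    y. If x' = y' the quotient is 0 and the line is horizontal, which does not affect the count
    |B|^4. *)
Let line (t : (R * R) * (R * R)) : R * R :=
  let v := ((t.1.1 - t.1.2) / (t.2.1 - t.2.2))%R in (v, (t.1.1 - v * t.2.1)%R).
Let lines := [fset line t | t in (B `*` B) `*` (B `*` B)].

Let card_lines : #|` lines| <= #|` B| ^ 4.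
Proof.
apply: (leq_trans (leq_imfset_card _ _ _)) => /=.
by rewrite !card_fsetM (_ : _ * _ = #|` B| ^ 4) //; ring.
Qed.

(** Two sides of a triangle, multiplied by c. The third side is their sum, so the image is an
    additive relation of the kind counted by [card_popdiff_sums]. *)
Let scaled (w : ((R * R) * R) * R) : R * R :=
  (((w.1.1.1 - w.1.1.2) * w.2)%R, ((w.1.1.2 - w.1.2) * w.2)%R).

Let collisions s1 s2 s3 :=
  [fset t in (popular_triangles s1 s2 s3 `*` A) `*` (popular_triangles s1 s2 s3 `*` A) |
    scaled t.1 == scaled t.2].

Let A_neq0 c : c \in A -> c != 0%R.
Proof. by move=> cA; apply: contraNneq A0 => <-. Qed.

(* Two triangles with a common scaled image differ by an affine map of ratio
   c' / c, whose graph is a line meeting B x B in the three pairs of vertices. *)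
Let card_collisions s1 s2 s3 :
  #|` collisions s1 s2 s3| <= #|` A| * \sum_(l <- lines) line_count B l ^ 3.
Proof.
pose on (l : R * R) x := (l.1 * x + l.2)%R \in B.
pose W := [fset z in lines `*` ((B `*` B) `*` B) |
  [&& on z.1 z.2.1.1, on z.1 z.2.1.2 & on z.1 z.2.2]].
have -> : \sum_(l <- lines) line_count B l ^ 3 = #|` W|.
  rewrite card_fset_sum big_fsetM; apply: eq_bigr => l _; rewrite !big_fsetM /=.
  rewrite expnS -mulnn /line_count big_distrl /=; apply: eq_bigr => x _.
  rewrite big_distrlr big_distrr /=; apply: eq_bigr => y _.
  rewrite big_distrr /=; apply: eq_bigr => z _.
  by rewrite /on; do 3!case: (_ \in B).
rewrite -card_fsetM.
(* A collision is recovered from c, the line and the second triangle: the slope c' / c gives c', the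
   intercept gives the first vertex, and equality of the scaled images gives the other two. *)
apply: (@leq_card_fset _ _ (fun t => (t.1.2, ((t.2.2 / t.1.2,
    t.1.1.1.1 - t.2.2 / t.1.2 * t.2.1.1.1)%R, t.2.1)))).
  move=> [[[[x y] z] c] [[[x' y'] z'] c']] [[[[p q] r] d] [[[p' q'] r'] d']].
  rewrite !in_fset_sep !in_fsetM /= !xpair_eqE /scaled /=.
  move=> /andP[/andP[/andP[_ cA] _] /andP[/eqP e1 /eqP e2]].
  move=> /andP[/andP[_ _] /andP[/eqP e3 /eqP e4]] [? e5 e6 ? ? ?].
  subst d p' q' r'; have c0 := A_neq0 cA.
  have cc : c' = d' by apply: (mulIf (invr_neq0 c0)).
  subst d'; move/addIr: e6 => xp; subst p.
  move: e1; rewrite -e3 => /(mulIf c0)/addrI/oppr_inj yq; subst q.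
  by move: e2; rewrite -e4 => /(mulIf c0)/addrI/oppr_inj ->.
move=> [[[[x y] z] c] [[[x' y'] z'] c']].
rewrite in_fset_sep !in_fsetM /= xpair_eqE /=.
case/andP=> /andP[/andP[th cA] /andP[th' c'A]] /andP[/eqP e1 /eqP e2].
move: th th'; rewrite !in_fset_sep !in_fsetM /=.
move=> /andP[/andP[/andP[xB yB] zB] _] /andP[/andP[/andP[x'B y'B] z'B] /and3P[/and3P[_ x'y'0 _] _ _]].
have c0 := A_neq0 cA; have c'0 := A_neq0 c'A.
have e1' : (x - y = c' / c * (x' - y'))%R.
  by apply: (mulIf c0); rewrite e1; field.
have e2' : (y - z = c' / c * (y' - z'))%R.
  by apply: (mulIf c0); rewrite e2; field.
rewrite cA x'B y'B z'B /= /on /= addrCA subrr addr0 xB.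
have -> : (c' / c * y' + (x - c' / c * x') = y)%R.
  by transitivity (x - (x - y))%R; [rewrite e1'|]; ring.
have -> : (c' / c * z' + (x - c' / c * x') = z)%R.
  by transitivity (x - (x - y) - (y - z))%R; [rewrite e1' e2'|]; ring.
rewrite yB zB !andbT; apply/imfsetP; exists ((x, y), (x', y')).
  by rewrite !in_fsetM /= xB yB x'B.
by rewrite /line /= e1' mulfK.
Qed.

(** Cauchy-Schwarz for [scaled] on triangles times A bounds (|P| N)^2 by the number of additive
    relations times the number of collisions. Cubing this inserts the bound for the cube of the
    former, whence the sixth power. *)
Lemma card_popular_triangles_ordered s1 s2 s3 : 0 < s1 -> 0 < s2 -> s1 <= s3 -> s2 <= s3 ->
  (((#|` popular_triangles s1 s2 s3| * (s1 * s2 * s3)) ^ 6)%:R <=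
  (incidence_const ^ 7 * m ^ 412 * #|` A| ^ 14)%:R *
    (3 * (incidence_const * #|` B| ^ 4)%:R * harmonic_sum #|` B|) ^+ 3 :> R)%R.
Proof.
move=> s10 s20 s13 s23; have s30 := leq_trans s10 s13.
set P := popular_triangles s1 s2 s3; set S := s1 * s2 * s3.
set N := #|` A|; set q := (3 * _ * _ : R)%R.
have q0 : (0 <= q)%R by rewrite !mulr_ge0 ?ler0n ?harmonic_sum_ge0.
have [->|P0] := posnP #|` P|.
  by rewrite mul0n exp0n // mulr_ge0 ?ler0n ?exprn_ge0.
have N0 : 0 < N by rewrite cardfs_gt0.
have D13 : popdiff (powfset A 1) s3 != fset0.
  move: P0; rewrite cardfs_gt0 => /fset0Pn[t].
  rewrite in_fset_sep => /andP[_ /and3P[_ _ tD]].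
  by apply/fset0Pn; exists (t.1.1 - t.2)%R.
have := card_popdiff_sums A0 An AAm s10 s20 s13 s23 D13.
rewrite -/N -/S; set T := [fset e in _ | _] => Tcube.
have PT : (#|` P| * N) ^ 2 <= #|` T| * #|` collisions s1 s2 s3|.
  rewrite /N -(card_fsetM P A); apply: card_sqr_le_collisions => -[[[x y] z] c].
  rewrite in_fsetM in_fset_sep !in_fsetM /=.
  move=> /andP[/andP[_ /and3P[xy yz xz]] cA].
  rewrite in_fset_sep in_fsetM /scaled /= -mulrDl addrA subrK.
  by rewrite powfsetS !popdiff_mul.
have line3 : ((\sum_(l <- lines) line_count B l ^ 3)%N%:R <= q)%R.
  rewrite natr_sum; under eq_bigr do rewrite natrX.
  exact: sum_line_count_cube.
have PTq : ((#|` P| ^ 2 * N)%:R <= #|` T|%:R * q)%R.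
  rewrite -(ler_pM2l (_ : 0 < N%:R :> R)%R) ?ltr0n // -natrM.
  apply: (@le_trans _ _ ((#|` T| * (N * \sum_(l <- lines) line_count B l ^ 3))%N%:R)%R).
    rewrite ler_nat (_ : N * _ = (#|` P| * N) ^ 2); last by ring.
    by apply: (leq_trans PT); rewrite leq_mul2l card_collisions orbT.
  by rewrite mulnCA !natrM ler_wpM2l ?ler0n // ler_wpM2l ?ler0n.
have {PTq}PTq : ((#|` P| ^ 6 * N ^ 3)%:R <= (#|` T| ^ 3)%:R * q ^+ 3)%R.
  rewrite natrX -exprMn (_ : #|` P| ^ 6 * N ^ 3 = (#|` P| ^ 2 * N) ^ 3); last by ring.
  by rewrite natrX ler_pXn2r ?nnegrE ?ler0n // mulr_ge0 ?ler0n.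
rewrite -(ler_pM2l (_ : 0 < (N ^ 4)%:R :> R)%R) ?ltr0n ?expn_gt0 ?N0 // -natrM.
rewrite (_ : N ^ 4 * _ = (#|` P| ^ 6 * N ^ 3) * (N * S ^ 6)); last by ring.
rewrite natrM; apply: (le_trans (ler_wpM2r (ler0n _ _) PTq)).
rewrite [leLHS]mulrAC [leRHS]mulrA ler_wpM2r ?exprn_ge0 // -!natrM ler_nat mulnCA mulnA.
by apply: (leq_trans Tcube); rewrite eq_leq //; ring.
Qed.

(** Exchanging the outer vertices exchanges the first two sides up to sign, and popular differences
    are symmetric. *)
Lemma popular_triangles13 s1 s2 s3 : 0 < s1 -> 0 < s2 -> 0 < s3 ->
  #|` popular_triangles s1 s2 s3| <= #|` popular_triangles s2 s1 s3|.
Proof.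
move=> s10 s20 s30; apply: (@leq_card_fset _ _ (fun t => ((t.2, t.1.2), t.1.1))).
  by move=> [[x y] z] [[x' y'] z'] _ _ /= [-> -> ->].
move=> [[x y] z]; rewrite !(in_fset_sep ((B `*` B) `*` B)) !in_fsetM /=.
move=> /andP[/andP[/andP[-> ->] ->] /and3P[xy yz xz]] /=.
by rewrite -(popdiffN _ (z - y)%R s20) -(popdiffN _ (y - x)%R s10) -(popdiffN _ (z - x)%R s30)
  !opprB xy yz xz.
Qed.

Lemma popular_triangles23 s1 s2 s3 : 0 < s1 -> 0 < s2 -> 0 < s3 ->
  #|` popular_triangles s1 s2 s3| <= #|` popular_triangles s3 s2 s1|.
Proof.
move=> s10 s20 s30; apply: (@leq_card_fset _ _ (fun t => ((t.1.1, t.2), t.1.2))).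
  by move=> [[x y] z] [[x' y'] z'] _ _ /= [-> -> ->].
move=> [[x y] z]; rewrite !(in_fset_sep ((B `*` B) `*` B)) !in_fsetM /=.
move=> /andP[/andP[/andP[-> ->] ->] /and3P[xy yz xz]] /=.
by rewrite -(popdiffN _ (z - y)%R s20) opprB xy yz xz.
Qed.

(** The bound is symmetric in the thresholds, so the vertices can be relabelled to put the largest
    threshold last. *)
Lemma card_popular_triangles s1 s2 s3 : 0 < s1 -> 0 < s2 -> 0 < s3 ->
  (((#|` popular_triangles s1 s2 s3| * (s1 * s2 * s3)) ^ 6)%:R <=
  (incidence_const ^ 7 * m ^ 412 * #|` A| ^ 14)%:R *
    (3 * (incidence_const * #|` B| ^ 4)%:R * harmonic_sum #|` B|) ^+ 3 :> R)%R.
Proof.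
move=> s10 s20 s30; have [s12|s21] := leqP s1 s2; last first.
  have [s13|s31] := leqP s1 s3; first by apply: card_popular_triangles_ordered => //; lia.
  apply: le_trans (card_popular_triangles_ordered s30 s20 (ltnW s31) (ltnW s21)).
  rewrite ler_nat leq_exp2r // (_ : s3 * s2 * s1 = s1 * s2 * s3); last by ring.
  by rewrite leq_mul2r popular_triangles23 ?orbT.
have [s23|s32] := leqP s2 s3; first by apply: card_popular_triangles_ordered => //; lia.
apply: le_trans (card_popular_triangles_ordered s30 s10 (ltnW s32) s12).
rewrite ler_nat leq_exp2r // (_ : s3 * s1 * s2 = s1 * s2 * s3); last by ring.
rewrite leq_mul2r (leq_trans (popular_triangles13 s10 s20 s30)) ?orbT //.
exact: popular_triangles23.
Qed.

End Triangles.

(** * The energy bound *)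

Lemma exists_root (R : realType) (x : R) k : (0 <= x)%R -> exists2 y : R, (0 <= y)%R & (y ^+ k.+1 = x)%R.
Proof.
move=> x0; exists (x `^ k.+1%:R^-1)%R; first exact: powR_ge0.
by rewrite -powR_mulrn ?powR_ge0 // -powRrM mulVf ?pnatr_eq0 // powRr1.
Qed.

(** Replaces the logarithm by a small power. With x and y the roots of n and n + 1, 1 = y^(k+1) -
    x^(k+1) <= (k + 1) y^k (y - x), and y >= 1, so the new term 1 / y^(k+1) is at most (k + 1) (y -
    x). *)
Lemma harmonic_sum_le (R : realType) (n : nat) k :
  (harmonic_sum n <= k.+1%:R * n%:R `^ k.+1%:R^-1 :> R)%R.
Proof.
elim: n => [|n IHn].
  by rewrite /harmonic_sum big_geq // mulr_ge0 ?ler0n ?powR_ge0.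
rewrite /harmonic_sum big_nat_recr //= -/(harmonic_sum n).
apply: (le_trans (lerD IHn (lexx _))).
have root (m : nat) : ((m%:R `^ k.+1%:R^-1) ^+ k.+1 = m%:R :> R)%R.
  by rewrite -powR_mulrn ?powR_ge0 // -powRrM mulVf ?pnatr_eq0 // powRr1.
move: (root n) (root n.+1).
have : (n%:R `^ k.+1%:R^-1 <= n.+1%:R `^ k.+1%:R^-1 :> R)%R.
  by apply: ge0_ler_powR; rewrite ?nnegrE ?ler0n ?invr_ge0 ?ler_nat.
have : (0 <= n%:R `^ k.+1%:R^-1 :> R)%R by exact: powR_ge0.
set x := (n%:R `^ _)%R; set y := (n.+1%:R `^ _)%R => x0 xy xn yn.
have y1 : (1 <= y)%R.
  apply: (@le_trans _ _ (1 `^ k.+1%:R^-1)%R); first by rewrite powR1.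
  apply: ge0_ler_powR; rewrite ?nnegrE ?ler0n ?invr_ge0 ?ler0n //.
  by rewrite ler1n.
have y0 : (0 <= y)%R by rewrite (le_trans ler01).
have H : (1 <= k.+1%:R * y ^+ k * (y - x))%R.
  rewrite [leLHS](_ : _ = y ^+ k.+1 - x ^+ k.+1)%R; last by rewrite yn xn -natrB ?subSnn.
  rewrite subrXX mulrC ler_wpM2r ?subr_ge0 //.
  apply: (@le_trans _ _ (\sum_(i < k.+1) y ^+ k)%R).
    apply: ler_sum => i _; rewrite -[in leRHS](@subnK i k) -1?ltnS // exprD.
    by rewrite ler_wpM2l ?exprn_ge0 // lerXn2r.
  by rewrite sumr_const card_ord mulr_natl.
rewrite -lerBrDl -mulrBr -[leLHS]mul1r ler_pdivrMr ?ltr0n //.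
apply: (le_trans H); rewrite -yn exprS.
rewrite [leRHS](_ : _ = k.+1%:R * y ^+ k * (y - x) * y)%R; last by ring.
by rewrite ler_peMr // !mulr_ge0 ?ler0n ?exprn_ge0 ?subr_ge0.
Qed.

Lemma powfset1 (F : fieldType) (A : {fset F}) : powfset A 1 = A.
Proof.
apply/fsetP => x; apply/mulfsetP/idP => [[a [b [aA]]]|xA].
  by rewrite inE => /eqP -> ->; rewrite mulr1.
by exists x, 1%R; rewrite inE mulr1.
Qed.

Lemma diff_rep_le (F : fieldType) (A : {fset F}) x : diff_rep A x <= #|` A|.
Proof. by rewrite -sum1_size; apply: leq_sum => a _; case: (_ \in _). Qed.

Definition energy_sum (F : fieldType) (A B : {fset F}) :=
  \sum_(b <- B) \sum_(b' <- B) diff_rep A (b - b')%R.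

Definition offdiag_rep (F : fieldType) (A : {fset F}) (b b' : F) :=
  if b == b' then 0 else diff_rep A (b - b')%R.

Lemma exchange_big3 (I J : Type) (r : seq I) (s : seq J) (F : I -> I -> I -> J -> nat) :
  \sum_(a <- r) \sum_(b <- r) \sum_(c <- r) \sum_(j <- s) F a b c j =
  \sum_(j <- s) \sum_(a <- r) \sum_(b <- r) \sum_(c <- r) F a b c j.
Proof.
rewrite [RHS]exchange_big; apply: eq_bigr => a _.
rewrite [RHS]exchange_big; apply: eq_bigr => b _.
exact: exchange_big.
Qed.

Section EnergyBound.
Context {R : realType} (A B : {fset R}) (m : nat).
Hypotheses (A0 : 0%R \notin A) (An : A != fset0).
Hypothesis AAm : #|` mulfset A A| <= m * #|` A|.
Let N := #|` A|.
Let n := #|` B|.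
Hypotheses (NB : N <= n ^ 2) (BN : n <= N ^ 2).
Let H k : R := harmonic_sum k.

(** Column b is the indicator of the translate A - b. Two translates meet in r(b - b') points, all
    of them in [X], so the Gram matrix is the one defining the energy. *)
Let shift (x b : R) : R := ((x + b)%R \in A)%:R%R.
Let X := [fset (a - b)%R | a in A, b in B].

Let gram_shift b b' : b \in B ->
  gram X shift b b' = (diff_rep A (b - b')%R)%:R%R.
Proof.
move=> bB; rewrite /gram /shift; under eq_bigr do rewrite -natrM mulnb.
rewrite -natr_sum; congr (_%:R)%R; rewrite /diff_rep -!card_fset_sum.
apply/eqP; rewrite eqn_leq; apply/andP; split.
  apply: (@leq_card_fset _ _ (fun x => x + b)%R) => [x y _ _|x]; first exact: addIr.
  rewrite !in_fset_sep => /and3P[_ -> /=].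
  by rewrite (_ : x + b - (b - b') = x + b')%R //; ring.
apply: (@leq_card_fset _ _ (fun a => a - b)%R) => [x y _ _|a]; first exact: addIr.
rewrite !in_fset_sep => /andP[aA abA]; rewrite subrK aA /=; apply/andP; split.
  by apply/imfset2P; exists a => //; exists b.
by rewrite (_ : a - b + b' = a - (b - b'))%R //; ring.
Qed.

Let offdiag_shift b b' : b \in B ->
  offdiag_gram X shift b b' = (offdiag_rep A b b')%:R%R.
Proof. by move=> bB; rewrite /offdiag_gram /offdiag_rep gram_shift //; case: ifP. Qed.

Let offdiag_rep_layers b b' : offdiag_rep A b b' =
  \sum_(1 <= s < N.+1) ((b - b')%R \in popdiff (powfset A 1) s : nat).
Proof.
rewrite /offdiag_rep powfset1 -subr_eq0; case: eqVneq => [->|bb'].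
  by rewrite big1 // => s _; apply/eqP; rewrite eqb0; apply/negP => /popdiff_neq0/eqP.
have rN := diff_rep_le A (b - b')%R.
rewrite (big_cat_nat (n := (diff_rep A (b - b')%R).+1)) ?ltnS //=.
rewrite [X in _ + X]big_nat [X in _ + X]big1 ?addn0; last first.
  move=> s /andP[ss _]; apply/eqP; rewrite eqb0 mem_popdiff ?bb' -?ltnNge //.
  exact: leq_trans ss.
rewrite big_nat (eq_bigr (fun=> 1)) -?big_nat; last first.
  by move=> s /andP[s0 ss]; rewrite mem_popdiff // bb' -ltnS ss.
by rewrite sum_nat_const_nat subn1 muln1.
Qed.

(** Each factor is the number of thresholds up to N that its difference reaches. Expanding the
    product turns the trace into a sum of triangle counts, each at most W / (s1 s2 s3). *)
Let triangle_sum (W : R) :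
  (forall s1 s2 s3, 0 < s1 -> 0 < s2 -> 0 < s3 ->
    (#|` popular_triangles A B s1 s2 s3|%:R * (s1 * s2 * s3)%N%:R <= W)%R) ->
  ((\sum_(a <- B) \sum_(b <- B) \sum_(c <- B)
     offdiag_rep A a b * offdiag_rep A b c * offdiag_rep A a c)%N%:R <= W * H N ^+ 3)%R.
Proof.
move=> WP.
have -> : (\sum_(a <- B) \sum_(b <- B) \sum_(c <- B)
     offdiag_rep A a b * offdiag_rep A b c * offdiag_rep A a c) =
   \sum_(1 <= s1 < N.+1) \sum_(1 <= s2 < N.+1) \sum_(1 <= s3 < N.+1)
     #|` popular_triangles A B s1 s2 s3|.
  transitivity (\sum_(a <- B) \sum_(b <- B) \sum_(c <- B)
    \sum_(1 <= s1 < N.+1) \sum_(1 <= s2 < N.+1) \sum_(1 <= s3 < N.+1)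
     ([&& (a - b)%R \in popdiff (powfset A 1) s1,
          (b - c)%R \in popdiff (powfset A 1) s2 &
          (a - c)%R \in popdiff (powfset A 1) s3] : nat)).
    apply: eq_bigr => a _; apply: eq_bigr => b _; apply: eq_bigr => c _.
    rewrite !offdiag_rep_layers big_distrlr big_distrl /=; apply: eq_bigr => s1 _.
    rewrite big_distrlr /=; apply: eq_bigr => s2 _; apply: eq_bigr => s3 _.
    by rewrite !mulnb andbA.
  rewrite exchange_big3; apply: eq_bigr => s1 _.
  rewrite exchange_big3; apply: eq_bigr => s2 _.
  rewrite exchange_big3; apply: eq_bigr => s3 _.
  by rewrite [RHS]card_fset_sum !big_fsetM.
rewrite natr_sum.
apply: (@le_trans _ _ (\sum_(1 <= s1 < N.+1) \sum_(1 <= s2 < N.+1) \sum_(1 <= s3 < N.+1)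
     W * (s1%:R^-1 * (s2%:R^-1 * s3%:R^-1)))%R).
  rewrite big_nat [leRHS]big_nat; apply: ler_sum => s1 /andP[s10 _].
  rewrite natr_sum big_nat [leRHS]big_nat; apply: ler_sum => s2 /andP[s20 _].
  rewrite natr_sum big_nat [leRHS]big_nat; apply: ler_sum => s3 /andP[s30 _].
  rewrite -!invfM ler_pdivlMr ?mulr_gt0 ?ltr0n // -!natrM (mulnA s1) natrM.
  exact: WP.
rewrite le_eqVlt; apply/orP; left; apply/eqP.
rewrite /H /harmonic_sum exprS expr2 big_distrlr big_distrl big_distrr /=.
apply: eq_bigr => s1 _; rewrite !big_distrr /=; apply: eq_bigr => s2 _.
by rewrite !big_distrr.
Qed.

Let pair_sum (K : R) :
  (forall s, 0 < s -> (#|` [fset t in B `*` B | (t.1 - t.2)%R \in popdiff (powfset A 1) s]|%:R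
      * s%:R ^+ 2 <= K)%R) ->
  ((\sum_(a <- B) \sum_(b <- B) offdiag_rep A a b ^ 2)%N%:R <= 2 * K * H N)%R.
Proof.
move=> KP; rewrite -(big_fsetM _ B B (fun t => offdiag_rep A t.1 t.2 ^ 2)) natr_sum.
under eq_bigr do rewrite natrX.
apply: sum_expr_layers => [t _|s s0].
  by rewrite /offdiag_rep; case: ifP => // _; exact: diff_rep_le.
rewrite (_ : [fset _ in _ | _] =
  [fset t in B `*` B | (t.1 - t.2)%R \in popdiff (powfset A 1) s]) ?KP //.
apply/fsetP => t; rewrite !(in_fset_sep (B `*` B)) powfset1 mem_popdiff // subr_eq0.
by rewrite /offdiag_rep; case: eqVneq => //=; rewrite leqNgt s0.
Qed.

(** With W the sixth root of the triangle bound, the trace inequality gives E^3 <= 12 n^3 W H(N)^3;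
    a sixth power then removes the root. *)
Lemma energy_sum_bound : 2 * N * n <= energy_sum A B ->
  ((energy_sum A B)%:R ^+ 18 <=
   12 ^+ 6 * 27 * (incidence_const ^ 10 * m ^ 412 * n ^ 30 * N ^ 14)%:R * H N ^+ 18 * H n ^+ 3 :> R)%R.
Proof.
set E := energy_sum A B => NE.
have n0 : 0 < n.
  by move: NB; rewrite lt0n; apply: contraTneq => ->; rewrite -ltnNge cardfs_gt0.
have m0 : 0 < m.
  have /fset0Pn[a aA] := An.
  have /leq_trans/(_ AAm) : 0 < #|` mulfset A A|.
    by rewrite cardfs_gt0; apply/fset0Pn; exists (a * a)%R; rewrite mem_mulfset.
  by rewrite muln_gt0 => /andP[].
have H1 k : 0 < k -> (1 <= H k)%R.
  case: k => // k _; rewrite /H /harmonic_sum big_nat_recl //= invr1 lerDl.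
  by apply: sumr_ge0 => s _; rewrite invr_ge0 ler0n.
have HN1 : (1 <= H N)%R by apply: H1; rewrite cardfs_gt0.
have Hn1 := H1 _ n0.
have Hn0 : (0 <= H n)%R by rewrite (le_trans ler01).
pose q : R := (3 * (incidence_const * n ^ 4)%:R * H n)%R.
have q0 : (0 <= q)%R by rewrite !mulr_ge0 ?ler0n.
have [W W0 W6] : exists2 W : R, (0 <= W)%R &
    (W ^+ 6 = (incidence_const ^ 7 * m ^ 412 * N ^ 14)%:R * q ^+ 3)%R.
  by apply: exists_root; rewrite mulr_ge0 ?ler0n ?exprn_ge0.
have [K K0 K3] : exists2 K : R, (0 <= K)%R &
    (K ^+ 3 = (incidence_const ^ 3 * m ^ 140 * n ^ 4 * N ^ 5)%:R)%R.
  by apply: exists_root; rewrite ler0n.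
have /triangle_sum Tr : forall s1 s2 s3, 0 < s1 -> 0 < s2 -> 0 < s3 ->
    (#|` popular_triangles A B s1 s2 s3|%:R * (s1 * s2 * s3)%N%:R <= W)%R.
  move=> s1 s2 s3 s10 s20 s30; rewrite -natrM.
  rewrite -(@ler_pXn2r _ 6) ?nnegrE ?ler0n // W6 -natrX.
  exact: card_popular_triangles.
have /pair_sum Fr : forall s, 0 < s ->
    (#|` [fset t in B `*` B | (t.1 - t.2)%R \in popdiff (powfset A 1) s]|%:R
      * s%:R ^+ 2 <= K)%R.
  move=> s s0; rewrite -natrX -natrM.
  rewrite -(@ler_pXn2r _ 3) ?nnegrE ?ler0n // K3 -natrX ler_nat.
  exact: card_pairs_popdiff.
(* The pair term is absorbed in the triangle term; after taking sixth powers the decisive comparison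
   is N^2 <= n^4. *)
have KW : (N%:R * K <= W)%R.
  rewrite -(@ler_pXn2r _ 6) ?nnegrE ?mulr_ge0 ?ler0n // W6 exprMn.
  rewrite (_ : K ^+ 6 = (K ^+ 3) ^+ 2)%R; last by ring.
  rewrite K3 -!natrX -natrM /q [in leRHS]exprMn mulrA.
  apply: (@le_trans _ _ ((incidence_const ^ 7 * m ^ 412 * N ^ 14)%:R *
      (3 * (incidence_const * n ^ 4)%:R) ^+ 3)%R); last first.
    by rewrite ler_peMr ?exprn_ege1 // mulr_ge0 ?exprn_ge0 ?mulr_ge0 ?ler0n.
  rewrite -natrM -natrX -natrM ler_nat.
  rewrite [leqLHS](_ : _ = 1 * incidence_const ^ 6 * m ^ 280 * n ^ 8 * N ^ 14 * (N ^ 2));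
    last by ring.
  rewrite [leqRHS](_ : _ = 27 * incidence_const ^ 10 * m ^ 412 * n ^ 8 * N ^ 14 * (n ^ 2) ^ 2);
    last by ring.
  apply: leq_mul; last by rewrite leq_exp2r.
  do 2![apply: leq_mul => //].
  apply: leq_mul; last by rewrite leq_pexp2l.
  by apply: leq_mul => //; rewrite leq_pexp2l ?incidence_const_gt0.
have gramE : (\sum_(b <- B) \sum_(b' <- B) gram X shift b b' = E%:R)%R.
  rewrite /E /energy_sum natr_sum big_seq [RHS]big_seq; apply: eq_bigr => b bB.
  by rewrite natr_sum; apply: eq_bigr => b' _; rewrite gram_shift.
have diagE b : b \in B -> gram X shift b b = N%:R%R.
  move=> bB; rewrite gram_shift // subrr /diff_rep; congr (_%:R)%R.
  by rewrite -[RHS]sum1_size big_seq [RHS]big_seq; apply: eq_bigr => a aA; rewrite subr0 aA.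
have prem : (2 * N%:R * n%:R <= E%:R :> R)%R by rewrite -!natrM ler_nat.
have := offdiag_gram_trace (fset_uniq B) diagE; rewrite gramE => /(_ prem).
rewrite (_ : \sum_(a <- B) \sum_(b <- B) \sum_(c <- B) _ = (\sum_(a <- B) \sum_(b <- B) \sum_(c <- B)
     offdiag_rep A a b * offdiag_rep A b c * offdiag_rep A a c)%N%:R)%R; last first.
  rewrite natr_sum big_seq [RHS]big_seq; apply: eq_bigr => a aB.
  rewrite natr_sum big_seq [RHS]big_seq; apply: eq_bigr => b bB.
  rewrite natr_sum; apply: eq_bigr => c _.
  by rewrite !offdiag_shift // !natrM.
rewrite (_ : \sum_(a <- B) \sum_(b <- B) offdiag_gram X shift a b ^+ 2 =
    (\sum_(a <- B) \sum_(b <- B) offdiag_rep A a b ^ 2)%N%:R)%R; last first.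
  rewrite natr_sum big_seq [RHS]big_seq; apply: eq_bigr => a aB.
  by rewrite natr_sum; apply: eq_bigr => b _; rewrite offdiag_shift // natrX.
move=> E3.
(* The constant is 4 (1 + 2): the triangles give W H(N)^3 and the pairs at most 2 W H(N)^3. *)
have {E3}E3 : (E%:R ^+ 3 <= 12 * n%:R ^+ 3 * (W * H N ^+ 3) :> R)%R.
  apply: (le_trans E3).
  rewrite [leRHS](_ : _ = 4 * n%:R ^+ 3 * (W * H N ^+ 3 + 2 * (W * H N ^+ 3)))%R; last by ring.
  rewrite ler_wpM2l ?mulr_ge0 ?exprn_ge0 ?ler0n // lerD //.
  apply: (le_trans (ler_wpM2l (ler0n _ _) Fr)).
  rewrite (_ : N%:R * _ = 2 * (N%:R * K * H N))%R; last by ring.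
  rewrite ler_wpM2l //; apply: ler_pM => //; first by rewrite mulr_ge0 ?ler0n.
    exact: harmonic_sum_ge0.
  by rewrite ler_eXnr.
have {E3}E18 : (E%:R ^+ 18 <= (12 * n%:R ^+ 3 * (W * H N ^+ 3)) ^+ 6 :> R)%R.
  rewrite [leLHS](_ : _ = (E%:R ^+ 3) ^+ 6)%R; last by ring.
  have HN0 := harmonic_sum_ge0 N : (0 <= H N)%R.
  have E30 : (0 <= E%:R ^+ 3 :> R)%R by rewrite exprn_ge0.
  by rewrite ler_pXn2r // nnegrE (le_trans E30).
apply: (le_trans E18); rewrite le_eqVlt; apply/orP; left; apply/eqP.
transitivity (12 ^+ 6 * n%:R ^+ 18 * W ^+ 6 * H N ^+ 18)%R; first by ring.
rewrite W6 /q (natrM _ incidence_const) (_ : incidence_const ^ 10 * _ * _ * _ =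
  (incidence_const ^ 7 * m ^ 412 * N ^ 14) * incidence_const ^ 3 * n ^ 30); last by ring.
rewrite !(natrM _ (_ * _)) !natrX; ring.
Qed.

End EnergyBound.

(** * Energy as a sum over differences, and removal of zero *)

Lemma additive_energyE (R : realType) (A B : {fset R}) :
  additive_energy A B = energy_sum A B.
Proof.
rewrite /additive_energy card_fset_sum !big_fsetM /energy_sum /=.
transitivity (\sum_(a <- A) \sum_(b <- B) \sum_(b' <- B) ((a - (b - b'))%R \in A : nat)).
  apply: eq_bigr => a _.
  under eq_bigr do rewrite big_fsetM.
  rewrite exchange_big /=; apply: eq_bigr => b _.
  rewrite exchange_big /=; apply: eq_bigr => b' _.
  rewrite -(card_fset_sum A (fun a' => (a - b)%R == (a' - b')%R)).
  (* The element a' is determined by a, b and b', so the inner count is 0 or 1. *)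
  have e a' : ((a - b)%R == (a' - b')%R) = (a' == (a - (b - b'))%R).
    apply/eqP/eqP => [h|->]; last by ring.
    by transitivity (a - b + b')%R; [rewrite h subrK|ring].
  case: (boolP ((a - (b - b'))%R \in A)) => aA /=.
    apply/eqP/cardfs1P; exists (a - (b - b'))%R; apply/fsetP => a'.
    by rewrite in_fset_sep inE e; case: eqP => [->|]; rewrite ?aA ?andbF.
  apply/eqP; rewrite cardfs_eq0; apply/eqP/fsetP => a'.
  by rewrite in_fset_sep inE e; case: eqP => [->|]; rewrite ?(negPf aA) ?andbF.
rewrite exchange_big /=; apply: eq_bigr => b _.
by rewrite exchange_big.
Qed.

Lemma energy_sum_le (F : fieldType) (A B : {fset F}) :
  energy_sum A B <= #|` A| ^ 2 * #|` B|.
Proof.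
rewrite /energy_sum mulnC -[#|` B|]sum1_size big_distrl /=; apply: leq_sum => b _.
rewrite mul1n /diff_rep exchange_big /= -mulnn -[X in _ <= X * _]sum1_size big_distrl /=.
apply: leq_sum => a _; rewrite mul1n -card_fset_sum.
apply: (@leq_card_fset _ _ (fun b' => a - (b - b'))%R) => [x y _ _|x].
  by move=> /addrI/oppr_inj/addrI/oppr_inj.
by rewrite in_fset_sep => /andP[].
Qed.

(** Only the representations with a = 0 or a - x = 0 are lost. *)
Lemma diff_rep_del0 (F : fieldType) (A : {fset F}) x :
  diff_rep A x <= diff_rep (A `\ 0%R) x + 2.
Proof.
have one y : \sum_(a <- A) (a == y : nat) <= 1.
  rewrite -(card_fset_sum A (fun a => a == y)) -(cardfs1 y).
  by apply/fsubset_leq_card/fsubsetP => a; rewrite in_fset_sep inE => /andP[].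
have -> : diff_rep (A `\ 0%R) x =
    \sum_(a <- A) ((a != 0%R) && ((a - x)%R \in A `\ 0%R) : nat).
  rewrite /diff_rep -!card_fset_sum; congr #|` _|; apply/fsetP => a.
  by rewrite !in_fset_sep !inE -andbA andbCA.
apply: (@leq_trans (\sum_(a <- A) (((a != 0%R) && ((a - x)%R \in A `\ 0%R))
    + ((a == 0%R) + (a == x))))).
  apply: leq_sum => a _; rewrite !inE subr_eq0.
  by case: (a == 0%R); case: (a == x); case: (_ \in A).
by rewrite !big_split /= leq_add2l (leq_add (one _) (one _)).
Qed.

Lemma energy_sum_del0 (F : fieldType) (A B : {fset F}) :
  energy_sum A B <= energy_sum (A `\ 0%R) B + 2 * #|` B| ^ 2.
Proof.
apply: (@leq_trans (\sum_(b <- B) \sum_(b' <- B) (diff_rep (A `\ 0%R) (b - b')%R + 2))).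
  by apply: leq_sum => b _; apply: leq_sum => b' _; exact: diff_rep_del0.
rewrite /energy_sum; under eq_bigr do rewrite big_split /=.
rewrite big_split /= leq_add2l !big_const_seq !count_predT !iter_addn_0.
by rewrite eq_leq //; ring.
Qed.

(** * Exponents and the final estimate *)

Local Open Scope ring_scope.

Lemma powR_nat_frac (R : realType) (x r s : R) k : 0 <= x -> r = s * k%:R ->
  x `^ r = (x `^ s) ^+ k.
Proof. by move=> x0 ->; rewrite powRrM powR_mulrn ?powR_ge0. Qed.

Lemma harmonic_sum_powR (R : realType) k (x : R) j :
  k%:R <= x ^+ (j * 144) -> 0 <= x -> harmonic_sum k <= 144 * x ^+ j :> R.
Proof.
move=> kx x0; apply: (le_trans (harmonic_sum_le R k 143)).
rewrite ler_wpM2l // -(@ler_pXn2r _ 144) ?nnegrE ?powR_ge0 ?exprn_ge0 //.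
by rewrite -exprM -(powR_nat_frac (r := 1)) ?mulVf ?pnatr_eq0 // powRr1.
Qed.

(* With |A| = a^144 and |B| = b^3 all exponents become integers, and the target
   |B|^(5/3) |A|^(5/6 - 1/36) is b^5 a^116. *)
Lemma energy_sum_nonzero (R : realType) (A B : {fset R}) (m : nat) (a b : R) :
  0 \notin A -> A != fset0 -> (#|` mulfset A A| <= m * #|` A|)%N ->
  (#|` A| <= #|` B| ^ 2)%N -> (#|` B| <= #|` A| ^ 2)%N ->
  (2 * #|` A| * #|` B| <= energy_sum A B)%N ->
  1 <= a -> 1 <= b -> #|` A|%:R <= a ^+ 144 -> #|` B|%:R = b ^+ 3 ->
  (energy_sum A B)%:R <=
    12 ^+ 6 * 27 * 144 ^+ 21 * incidence_const%:R ^+ 10 * m%:R ^+ 23 * (b ^+ 5 * a ^+ 116).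
Proof.
move=> A0 An AAm AB BA EAB a1 b1 Na nb.
have a0 : 0 <= a by rewrite (le_trans ler01).
have b0 : 0 <= b by rewrite (le_trans ler01).
have m1 : 1 <= m%:R :> R.
  rewrite ler1n; have /fset0Pn[x xA] := An.
  have /leq_trans/(_ AAm) : (0 < #|` mulfset A A|)%N.
    by rewrite cardfs_gt0; apply/fset0Pn; exists (x * x)%R; rewrite mem_mulfset.
  by rewrite muln_gt0 => /andP[].
have HN : harmonic_sum #|` A| <= 144 * a ^+ 1 by exact: harmonic_sum_powR.
have Hn : harmonic_sum #|` B| <= 144 * a ^+ 2.
  apply: harmonic_sum_powR => //; rewrite mulnC exprM.
  apply: (@le_trans _ _ (#|` A|%:R ^+ 2)); first by rewrite -natrX ler_nat.
  by rewrite ler_pXn2r // nnegrE ?exprn_ge0.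
have := energy_sum_bound A0 An AAm AB BA EAB.
have -> : (incidence_const ^ 10 * m ^ 412 * #|` B| ^ 30 * #|` A| ^ 14)%N%:R =
    incidence_const%:R ^+ 10 * m%:R ^+ 412 * #|` B|%:R ^+ 30 * #|` A|%:R ^+ 14 :> R.
  by rewrite -!natrX -!natrM.
move: HN Hn (harmonic_sum_ge0 #|` A| : 0 <= _ :> R) (harmonic_sum_ge0 #|` B| : 0 <= _ :> R).
move: (harmonic_sum #|` A|) (harmonic_sum #|` B|) => H1 H2 H1le H2le H10 H20.
rewrite nb; have : 0 <= #|` A|%:R :> R by [].
move: (#|` A|%:R) Na => N Na N0.
have : 1 <= incidence_const%:R :> R by rewrite ler1n incidence_const_gt0.
have : 1 <= 12 ^+ 6 * 27 :> R by apply: mulr_ege1; [apply: exprn_ege1|]; rewrite ler1n.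
have : 1 <= 144 :> R by rewrite ler1n.
have : 0 <= (energy_sum A B)%:R :> R by [].
move: ((energy_sum A B)%:R) (12 ^+ 6 * 27) (144) (incidence_const%:R) (m%:R) m1 H1le H2le.
move=> E K h st M M1 H1le H2le E0 h1 K1 st1 E18.
have pos x : 1 <= x -> 0 <= x :> R by apply: le_trans.
have leX (x y : R) k : 0 <= x -> x <= y -> x ^+ k <= y ^+ k.
  by move=> x0 xy; rewrite lerXn2r ?nnegrE // (le_trans x0).
have [M0 h0 K0 st0] := And4 (pos _ M1) (pos _ h1) (pos _ K1) (pos _ st1).
have K'1 : 1 <= K * h ^+ 21 * st ^+ 10 by rewrite !mulr_ege1 ?exprn_ege1.
have K'0 := pos _ K'1.
have up : E ^+ 18 <= K * (st ^+ 10 * M ^+ 412 * (b ^+ 3) ^+ 30 * (a ^+ 144) ^+ 14) *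
   (h * a ^+ 1) ^+ 18 * (h * a ^+ 2) ^+ 3.
  apply: (le_trans E18); apply: ler_pM; last exact: leX.
  - by do ?[apply: exprn_ge0|apply: mulr_ge0].
  - by rewrite exprn_ge0.
  apply: ler_pM; last exact: leX.
  - by do ?[apply: exprn_ge0|apply: mulr_ge0].
  - by rewrite exprn_ge0.
  apply: (ler_wpM2l K0); apply: ler_wpM2l; first by do ?[apply: exprn_ge0|apply: mulr_ge0].
  by apply: leX.
rewrite -(@ler_pXn2r _ 18) ?nnegrE //; last by rewrite !mulr_ge0 ?exprn_ge0.
apply: (le_trans up).
(* The exponent of a is 144 * 14 + 18 + 6 = 2040, below 18 * 116 = 2088; that of M is 412, below 18
   * 23 = 414; those of b agree. *)
rewrite [leLHS](_ : _ = (K * h ^+ 21 * st ^+ 10) * (M ^+ 412 * (b ^+ 90 * a ^+ 2040)));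
  last by ring.
rewrite [leRHS](_ : _ = (K * h ^+ 21 * st ^+ 10) ^+ 18 * (M ^+ 414 * (b ^+ 90 * a ^+ 2088)));
  last by ring.
move: (K * _ * _) K'0 K'1 => K' K'0 K'1.
apply: ler_pM; [exact: K'0|by apply: mulr_ge0; [|apply: mulr_ge0]; apply: exprn_ge0|by rewrite ler_eXnr|].
apply: ler_pM; [exact: exprn_ge0|by apply: mulr_ge0; apply: exprn_ge0|by rewrite ler_weXn2l|].
by apply: ler_wpM2l; [rewrite exprn_ge0|rewrite ler_weXn2l].
Qed.

(** Zero is removed from A. If |B| exceeds the square of the remaining size, or if the remaining
    energy is below its diagonal scale, trivial bounds suffice; otherwise [energy_sum_nonzero]
    applies. *)
Lemma energy_sum_estimate (R : realType) (A B : {fset R}) (M a b : R) :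
  (1 < #|` A|)%N -> (1 < #|` B|)%N -> 1 <= M ->
  #|` mulfset A A|%:R <= M * #|` A|%:R -> (#|` A| <= #|` B| ^ 2)%N ->
  1 <= a -> 1 <= b -> #|` A|%:R = a ^+ 144 -> #|` B|%:R = b ^+ 3 ->
  (energy_sum A B)%:R <= (12 ^+ 6 * 27 * 144 ^+ 21 * incidence_const%:R ^+ 10 * 3 ^+ 23 + 4) *
    M ^+ 23 * (b ^+ 5 * a ^+ 116).
Proof.
move=> A1 B1 M1 AAM AB a1 b1 Na nb.
set T := b ^+ 5 * a ^+ 116; set K := (X in (X * 3 ^+ 23 + 4) * _).
have a0 : 0 <= a by apply: le_trans a1.
have b0 : 0 <= b by apply: le_trans b1.
have T0 : 0 <= T by apply: mulr_ge0; apply: exprn_ge0.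
have K0 : 0 <= K by do ?[apply: exprn_ge0|apply: mulr_ge0].
have M23 : 1 <= M ^+ 23 by apply: exprn_ege1.
have base x : x <= 4 * T -> x <= (K * 3 ^+ 23 + 4) * M ^+ 23 * T.
  move=> /le_trans; apply; apply: ler_wpM2r => //.
  rewrite -[leLHS]mulr1; apply: ler_pM => //.
  by rewrite lerDr; apply: mulr_ge0 => //; apply: exprn_ge0.
pose A' := A `\ 0.
have A'_le : (#|` A'| <= #|` A| <= #|` A'| + 1)%N.
  by rewrite [X in (_ <= X <= _)%N](cardfsD1 0) addnC leq_addr leq_add2l; case: (_ \in _).
have A'2 : (#|` A| <= 2 * #|` A'|)%N by lia.
have A'0 : A' != fset0 by rewrite -cardfs_gt0; lia.
have cancelX (x y : R) k : 0 <= x -> 0 <= y -> x ^+ k.+1 <= y ^+ k.+1 -> x <= y.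
  by move=> x0 y0; rewrite ler_pXn2r.
have leX (x y : R) k : 0 <= x -> x <= y -> x ^+ k <= y ^+ k.
  by move=> x0 xy; rewrite lerXn2r ?nnegrE // (le_trans x0).
have aX k : 0 <= a ^+ k by apply: exprn_ge0.
have bX k : 0 <= b ^+ k by apply: exprn_ge0.
(* This is the hypothesis |A| <= |B|^2, that is a^144 <= b^6. *)
have ab : a ^+ 24 <= b.
  apply: (cancelX _ _ 5) => //; rewrite -exprM -Na (exprM b 3 2) -nb -natrX.
  by rewrite ler_nat.
have Nn : #|` A|%:R * #|` B|%:R <= T.
  rewrite Na nb /T [leLHS](_ : _ = a ^+ 28 * (b ^+ 3 * a ^+ 116)); last by ring.
  rewrite [leRHS](_ : _ = b ^+ 2 * (b ^+ 3 * a ^+ 116)); last by ring.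
  apply: ler_wpM2r; first exact: mulr_ge0.
  apply: (@le_trans _ _ (a ^+ 48)); first by rewrite ler_weXn2l.
  by rewrite (exprM a 24 2); apply: leX.
have [BA|BA] := leqP #|` B| (#|` A'| ^ 2); last first.
  apply: base; apply: (@le_trans _ _ (#|` A|%:R ^+ 2 * #|` B|%:R)).
    by rewrite -natrX -natrM ler_nat energy_sum_le.
  have NN : #|` A|%:R ^+ 2 <= 4 * #|` B|%:R :> R.
    rewrite -natrX -natrM ler_nat (@leq_trans ((2 * #|` A'|) ^ 2)%N) ?leq_exp2r //.
    by rewrite expnMn leq_mul // ltnW.
  have a96 : a ^+ 96 <= 2 * b.
    apply: (cancelX _ _ 2) => //; first exact: mulr_ge0.
    rewrite -exprM (exprM a 144 2) -Na exprMn -nb (le_trans NN) //.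
    by apply: ler_wpM2r => //; rewrite -natrX ler_nat.
  rewrite Na nb /T [leLHS](_ : _ = a ^+ 172 * (b ^+ 3 * a ^+ 116)); last by ring.
  rewrite [leRHS](_ : _ = (2 * b) ^+ 2 * (b ^+ 3 * a ^+ 116)); last by ring.
  apply: ler_wpM2r; first exact: mulr_ge0.
  apply: (@le_trans _ _ (a ^+ 192)); first by rewrite ler_weXn2l.
  by rewrite (exprM a 96 2); apply: leX.
have nn : #|` B|%:R ^+ 2 <= T.
  have ba : b <= a ^+ 96.
    apply: (cancelX _ _ 2) => //; rewrite -exprM -nb (exprM a 144 2) -Na -natrX ler_nat.
    by apply: (leq_trans BA); rewrite leq_exp2r //; case/andP: A'_le.
  rewrite nb -exprM exprSr; apply: ler_wpM2l => //; apply: (le_trans ba).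
  by rewrite ler_weXn2l.
have E_le : (energy_sum A B)%:R <= (energy_sum A' B)%:R + 2 * #|` B|%:R ^+ 2 :> R.
  by rewrite -natrX -natrM -natrD ler_nat energy_sum_del0.
have [EA'|EA'] := leqP (2 * #|` A'| * #|` B|) (energy_sum A' B); last first.
  apply: base; apply: (le_trans E_le).
  have : (energy_sum A' B)%:R <= 2 * T :> R.
    apply: (@le_trans _ _ (2 * (#|` A|%:R * #|` B|%:R))); last exact: ler_wpM2l.
    rewrite -!natrM ler_nat (leq_trans (ltnW EA')) // -mulnA leq_mul // leq_mul //.
    by case/andP: A'_le.
  by move: nn; lra.
(* The factor 2 pays for |A| <= 2 |A'|. Rounding up still gives m <= 2 M + 1 <= 3 M, because M >=
   1. *)
pose m := (Num.truncn (2 * M)).+1.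
have M20 : 0 <= 2 * M by lra.
have /andP[m_le m_gt] := truncn_itv M20.
have A'0N : 0 \notin A' by rewrite !inE eqxx.
have m3 : m%:R <= 3 * M by rewrite /m -natr1; lra.
have A'm : (#|` mulfset A' A'| <= m * #|` A'|)%N.
  rewrite -(ler_nat R) natrM.
  apply: (@le_trans _ _ (M * (2 * #|` A'|%:R))); last first.
    by rewrite mulrA (mulrC M); apply: ler_wpM2r => //; exact: ltW.
  apply: (le_trans (_ : _ <= #|` mulfset A A|%:R)).
    rewrite ler_nat; apply/fsubset_leq_card/fsubsetP => _ /mulfsetP[x [y [xA yA ->]]].
    by move: xA yA; rewrite !inE => /andP[_ xA] /andP[_ yA]; exact: mem_mulfset.
  apply: (le_trans AAM); apply: ler_wpM2l; first exact: le_trans M1.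
  by rewrite -natrM ler_nat.
have := @energy_sum_nonzero R A' B m a b A'0N A'0 A'm.
rewrite -Na ler_nat -/T -/K => /(_ _ BA EA' a1 b1 _ nb) E'_le.
have {}E'_le : (energy_sum A' B)%:R <= K * 3 ^+ 23 * M ^+ 23 * T.
  apply: le_trans (E'_le _ _) _.
  - by apply: leq_trans AB; case/andP: A'_le.
  - by case/andP: A'_le.
  apply: ler_wpM2r => //; rewrite -mulrA; apply: ler_wpM2l => //.
  by rewrite -exprMn; apply: leX.
apply: (le_trans E_le).
rewrite [leRHS](_ : _ = K * 3 ^+ 23 * M ^+ 23 * T + 4 * (M ^+ 23 * T)); last by ring.
apply: lerD => //; apply: ler_pM => //; [exact: exprn_ge0|by rewrite ler_nat|].
by apply: (le_trans nn); rewrite -[leLHS]mul1r; apply: ler_wpM2r.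
Qed.

Theorem theorem10 (R : realType) :
  exists c C : R, [/\ 0 < c, 0 < C &
    forall (A B : {fset R}) (M : R),
      (1 < #|` A|)%N -> (1 < #|` B|)%N ->
      1 <= M ->
      #|` productset A|%:R <= M * #|` A|%:R ->
      (#|` A| <= #|` B| ^ 2)%N ->
      (additive_energy A B)%:R
        <= C * M `^ C * #|` B|%:R `^ (5 / 3) * #|` A|%:R `^ (5 / 6 - c)].
Proof.
set K : R := 12 ^+ 6 * 27 * 144 ^+ 21 * incidence_const%:R ^+ 10 * 3 ^+ 23 + 4.
have K0 : 0 < K.
  by apply: ltr_wpDl => //; do ?[apply: exprn_ge0|apply: mulr_ge0].
(* The saving 1/36 is half of the gap 5/6 - 7/9; the other half absorbs the logarithms. One constant
   K + 23 dominates both the factor K and the exponent 23 of M. *)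
exists 36^-1, (K + 23); split; [by rewrite invr_gt0|by rewrite addr_gt0|].
move=> A B M A1 B1 M1 AAM AB; rewrite additive_energyE.
have root_ge1 (k : nat) (s : R) : (0 < k)%N -> 0 <= s -> 1 <= k%:R `^ s.
  move=> k0 s0; apply: (@le_trans _ _ (1 `^ s)); first by rewrite powR1.
  by apply: ge0_ler_powR; rewrite ?nnegrE ?ler0n // ler1n.
have A0 := ltnW A1; have B0 := ltnW B1.
have := @energy_sum_estimate R A B M (#|` A|%:R `^ 144^-1) (#|` B|%:R `^ 3^-1) A1 B1 M1 AAM AB.
have A_ge0 : 0 <= #|` A|%:R :> R by [].
have B_ge0 : 0 <= #|` B|%:R :> R by [].
rewrite -(powR_nat_frac (r := 1) A_ge0) ?mulVf ?pnatr_eq0 // powRr1 //.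
rewrite -(powR_nat_frac (r := 1) B_ge0) ?mulVf ?pnatr_eq0 // powRr1 //.
rewrite -(powR_nat_frac (r := 5 / 3) B_ge0); last by field.
rewrite -(powR_nat_frac (r := 5 / 6 - 36^-1) A_ge0); last by field.
rewrite !root_ge1 ?invr_ge0 // -/K mulrA => /(_ isT isT erefl erefl)/le_trans; apply.
apply: ler_wpM2r; first exact: powR_ge0.
apply: ler_wpM2r; first exact: powR_ge0.
have M0 : 0 <= M by apply: le_trans M1.
apply: ler_pM; [exact: ltW|exact: exprn_ge0|by rewrite lerDl|].
by rewrite -powR_mulrn // ler_powR // lerDr ltW.
Qed.
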